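(* Let $H$ be a separable complex Hilbert space, let $\mathbf A:\mathcal D(\mathbf A)\subset H\to H$ be the generator of an exponentially stable $C_0$-semigroup $\mathbf S(t)\in\mathscr L(H)$ with $\|\mathbf S(t)\|_{\mathscr L(H)}\le Me^{-\alpha t}$ for all $t\ge 0$ (with constants $M,\alpha>0$), and let $\mathbf Q,\mathbf G\in\mathscr L^s(H)$ be symmetric positive semi-definite. Let $\mathbf X\in\mathscr L^s(H)$ be the unique positive semi-definite solution of the Bochner integral equation $$\mathbf X=\int_0^{+\infty}\mathbf S(t)\big(\mathbf Q-\mathbf X\mathbf G\mathbf X\big)\mathbf S^*(t)\,dt .$$ Then $\mathbf X$ is the unique (symmetric positive semi-definite) solution of the strong operator-valued Riccati equation $$\mathbf A\mathbf X+\mathbf X\mathbf A^*-\mathbf X\mathbf G\mathbf X+\mathbf Q=\mathbf 0,$$ i.e. $\mathbf A\mathbf X+\mathbf X\mathbf A^*$ is defined on all of $H$, belongs to $\mathscr L^s(H)$, and the identity holds in $\mathscr L(H)$. Furthermore, if in addition $\mathbf Q\in\mathscr J_1^s(H)$, then $\mathbf X\in\mathscr J_1^s(H)$ and $$\|\mathbf X\|_1\le\frac{M^2}{2\alpha}\|\mathbf Q\|_1 .$$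
   Context: $\mathscr L(H)$ denotes bounded linear operators on $H$, $\mathscr L^s(H)$ the symmetric (self-adjoint) ones. A symmetric $\mathbf T$ is positive semi-definite if $(\phi,\mathbf T\phi)_H\ge0$ for all $\phi\in H$. $\mathscr J_1(H)$ is the space of trace-class operators on $H$, $\mathscr J_1^s(H)$ its symmetric elements, with trace norm $\|\cdot\|_1$ (for symmetric positive semi-definite $\mathbf T$, $\|\mathbf T\|_1=\operatorname{tr}(\mathbf T)=\sum_k(e_k,\mathbf Te_k)_H$ for any orthonormal basis $\{e_k\}$). $\mathbf S^*(t)$ is the adjoint semigroup, generated by $\mathbf A^*$. A $C_0$-semigroup is exponentially stable if $\|\mathbf S(t)\|\le Me^{-\alpha t}$ for some $M,\alpha>0$. The generators are $\mathbf A\phi=\lim_{h\to0^+}h^{-1}(\mathbf S(h)\phi-\phi)$ on its domain, and similarly for $\mathbf A^*$.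
   Formalization: For unbounded A*, AX+XA* cannot be defined on all of H; the equation is stated for every x in D(A* ), with Xx in D(A), so AX+XA* equals the bounded operator XGX−Q there. The Bochner equation is stated tested against all pairs of vectors x, y. *)

(* Defs.v *)
From HB Require Import structures.
From mathcomp Require Import all_boot all_order all_algebra.
From mathcomp Require Import all_classical all_reals all_analysis.
From mathcomp Require Import complex.
Set Implicit Arguments. Unset Strict Implicit. Unset Printing Implicit Defensive.
Import Order.TTheory GRing.Theory Num.Theory.
Import numFieldNormedType.Exports.
Local Open Scope classical_set_scope.
Local Open Scope ring_scope.
Local Open Scope complex_scope.

Section HilbertDefs.
Variable R : realType.
Local Notation C := R[i].
Variable V : normedModType C.
Variable ip : V -> V -> C.   (* inner product (x, y), linear in x, antilinear in y *)

Definition is_inner_product : Prop :=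
  (forall (a : C) (x y z : V), ip (a *: x + y) z = a * ip x z + ip y z) /\
  (forall x y : V, ip y x = Num.conj (ip x y)) /\
  (forall x : V, ip x x = `|x| ^+ 2).

Definition separable_space : Prop :=
  exists D : set V, countable D /\ closure D = setT.

Definition bounded_op (T : V -> V) : Prop :=
  (forall (a : C) (x y : V), T (a *: x + y) = a *: T x + T y) /\ continuous T.

Definition symmetric_op (T : V -> V) : Prop :=
  forall x y, ip (T x) y = ip x (T y).

(* (phi, T phi) >= 0 ; for complex numbers, 0 <= z means z real and nonnegative *)
Definition psd_op (T : V -> V) : Prop :=
  forall x, 0 <= ip x (T x).

Definition C0_semigroup (S : R -> V -> V) : Prop :=
  (forall t, 0 <= t -> bounded_op (S t)) /\
  (forall x, S 0 x = x) /\
  (forall s t, 0 <= s -> 0 <= t -> forall x, S (s + t) x = S s (S t x)) /\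
  (forall x, S t x @[t --> (0:R)^'+] --> x).

Definition exp_bound (S : R -> V -> V) (M alpha : R) : Prop :=
  forall t, 0 <= t -> forall x, `|S t x| <= (M * expR (- (alpha * t))) %:C * `|x|.

Definition adjoint_family (S Ss : R -> V -> V) : Prop :=
  forall t, 0 <= t -> forall x y, ip (S t x) y = ip x (Ss t y).

(* generator: A x = y  iff  h^{-1}(S(h)x - x) --> y as h --> 0+ ;
   x is in D(A) iff such a limit exists *)
Definition gen_lim (S : R -> V -> V) (x y : V) : Prop :=
  (h^-1) %:C *: (S h x - x) @[h --> (0:R)^'+] --> y.

Definition in_gen_dom (S : R -> V -> V) (x : V) : Prop := exists y, gen_lim S x y.

(* strong Riccati equation  A Y + Y A^star - Y G Y + Q = 0 :
   for every x in D(A^star), Y x lies in D(A) and A(Y x) + Y(A^star x) - Y G Y x + Q x = 0 *)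
Definition strong_riccati (S Ss : R -> V -> V) (Q G Y : V -> V) : Prop :=
  forall x, in_gen_dom Ss x ->
    exists a b, gen_lim S (Y x) a /\ gen_lim Ss x b /\
                a + Y b - Y (G (Y x)) + Q x = 0.

Definition cintegrable0 (f : R -> C) : Prop :=
  (@lebesgue_measure R).-integrable `[0%R, +oo[ (fun t => (complex.Re (f t))%:E) /\
  (@lebesgue_measure R).-integrable `[0%R, +oo[ (fun t => (complex.Im (f t))%:E).

Definition cintegral0 (f : R -> C) : C :=
  Complex (Rintegral (@lebesgue_measure R) `[0%R, +oo[ (fun t => complex.Re (f t)))
          (Rintegral (@lebesgue_measure R) `[0%R, +oo[ (fun t => complex.Im (f t))).

(* X = \int_0^oo S(t) (Q - X G X) S^*(t) dt, tested against x, y: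
   (X x, y) = \int_0^oo (S(t)(Q - XGX)S^*(t) x, y) dt, the integrand being integrable *)
Definition riccati_integral_eq (S Ss : R -> V -> V) (Q G X : V -> V) : Prop :=
  forall x y,
    cintegrable0 (fun t => ip (S t (Q (Ss t x) - X (G (X (Ss t x))))) y) /\
    ip (X x) y = cintegral0 (fun t => ip (S t (Q (Ss t x) - X (G (X (Ss t x))))) y).

Definition orthonormal_basis (I : countType) (e : I -> V) : Prop :=
  (forall i j, ip (e i) (e j) = (i == j)%:R) /\
  closure [set x | exists (s : seq I) (c : I -> C), x = \sum_(i <- s) c i *: e i] = setT.

(* tr T = sum_k (e_k, T e_k), in \bar R (for psd T this is ||T||_1, possibly +oo) *)
Definition trace_psd (I : countType) (e : I -> V) (T : V -> V) : \bar R :=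
  (\esum_(i in [set: I]) (complex.Re (ip (e i) (T (e i))))%:E)%E.

End HilbertDefs.

(* Main.v *)
Require Import Defs.
From HB Require Import structures.
From mathcomp Require Import all_boot all_order all_algebra.
From mathcomp Require Import all_classical all_reals all_analysis.
From mathcomp Require Import measurable_realfun complex.
From mathcomp Require Import ring lra.
Set Implicit Arguments. Unset Strict Implicit. Unset Printing Implicit Defensive.
Import Order.TTheory GRing.Theory Num.Theory.
Import numFieldNormedType.Exports.
Local Open Scope classical_set_scope.
Local Open Scope ring_scope.

(** Everything is reduced to real scalars: a complex Hilbert space is a real one for the
    inner product [Re (x, y)], and all integrals are half-line integrals of real functions
    obtained by testing against vectors.

    Write [W := Q - X G X]. Shifting the integral equation by [h] gives
    [S h X S*h x - X x = - \int_0^h S t W S*t x dt]; together with the derivative of [S*h x]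
    this yields [X x] in the domain of [A] and [A X x = - W x - X A* x] when [x] is in the
    domain of [A*].

    Conversely, let [Y] solve the strong equation and let [B (x, y)] be [(Y x, y)] minus the
    half-line integral of [(W S*t x, S*t y)]. This bounded form satisfies
    [B (A* x, y) + B (x, A* y) = 0], so [B (S*t x, S*t y)] is constant in [t]; it tends to
    [0], hence [B = 0] on the domain of [A*]. That domain is dense because [A*] has the
    bounded inverse [- \int_0^oo S*t dt] (Riesz representation), which also shows that [S*]
    is strongly continuous. So [Y] solves the integral equation.

    For the trace bound, Cholesky elimination along the basis writes [(x, Q x)] as a sum of
    squares [|(x, v)|^2] up to an arbitrarily small error, whence
    [tr (S t Q S*t) = sum |S t v|^2 <= M^2 e^(-2 alpha t) tr Q]; no square root of [Q] is
    needed. *)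

(** * Integrals of real functions over the half line *)

Section HalfLineIntegral.
Context {R : realType}.
Local Notation mu := (@lebesgue_measure R).

Definition integrable_hl (f : R -> R) : Prop :=
  mu.-integrable `[0, +oo[ (EFin \o f).

Definition integral_hl (f : R -> R) : R := Rintegral mu `[0, +oo[ f.

Lemma eq_integral_hl (f g : R -> R) :
  (forall t, 0 <= t -> f t = g t) -> integral_hl f = integral_hl g.
Proof.
move=> fg; apply: eq_Rintegral => t; rewrite inE /= in_itv /= andbT.
exact: fg.
Qed.

Lemma eq_integrable_hl (f g : R -> R) :
  (forall t, 0 <= t -> f t = g t) -> integrable_hl f -> integrable_hl g.
Proof.
move=> fg; apply: eq_integrable => // t.
by rewrite inE /= in_itv /= andbT => t0; rewrite fg.
Qed.

Lemma integrable_hlD (f g : R -> R) : integrable_hl f -> integrable_hl g ->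
  integrable_hl (fun t => f t + g t).
Proof.
move=> fi gi; rewrite /integrable_hl (_ : _ \o _ = (EFin \o f) \+ (EFin \o g))%E.
  exact: integrableD.
by apply/funext => t /=; rewrite EFinD.
Qed.

Lemma integrable_hlZ (k : R) (f : R -> R) : integrable_hl f ->
  integrable_hl (fun t => k * f t).
Proof.
move=> fi; rewrite /integrable_hl.
rewrite (_ : _ \o _ = (fun t => k%:E * (EFin \o f) t)%E).
  exact: integrableZl.
by apply/funext => t /=; rewrite EFinM.
Qed.

Lemma integral_hlD (f g : R -> R) : integrable_hl f -> integrable_hl g ->
  integral_hl (fun t => f t + g t) = integral_hl f + integral_hl g.
Proof. by move=> fi gi; rewrite /integral_hl RintegralD. Qed.

Lemma integral_hlZ (k : R) (f : R -> R) : integrable_hl f ->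
  integral_hl (fun t => k * f t) = k * integral_hl f.
Proof. by move=> fi; rewrite /integral_hl RintegralZl. Qed.

Lemma le_integral_hl (f g : R -> R) : integrable_hl f -> integrable_hl g ->
  (forall t, 0 <= t -> f t <= g t) -> integral_hl f <= integral_hl g.
Proof.
move=> fi gi fg; apply: le_Rintegral => // t.
by rewrite /= in_itv /= andbT; exact: fg.
Qed.

Let shiftr (h : R) : measurableTypeR R -> measurableTypeR R := fun x => x + h.

Let measurable_shiftr (h : R) : measurable_fun setT (shiftr h).
Proof.
have : measurable_fun [set: R] (fun x : R => x + h) by exact: measurable_funD.
exact.
Qed.

Let pushshift (h : R) : {measure set (measurableTypeR R) -> \bar R} :=
  measure_function_pushforward__canonical__measure_function_Measure
    mu (measurable_shiftr h).

(** Translation invariance: the pushed-forward measure agrees with [mu] on half-open intervals, and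
    these determine Lebesgue measure. *)
Let lebesgue_measure_shift (h : R) (A : set (measurableTypeR R)) : measurable A ->
  mu A = pushshift h A.
Proof.
move=> mA; refine (@lebesgue_measure_unique R (pushshift h) _ A mA).
move=> B /ocitvP[->|[[a b] /= ab ->]]; first by rewrite !measure0.
rewrite /= /pushforward (_ : _ @^-1` _ = `](a - h), (b - h)]%classic); last first.
  by apply/seteqP; split => t /=; rewrite /shiftr !in_itv /=; lra.
rewrite !lebesgue_measure_itv /= !lte_fin ltrD2r; case: ifP => // _.
by rewrite -!EFinB; congr _%:E; ring.
Qed.

Let preimage_shiftr (h : R) : shiftr h @^-1` `[h, +oo[%classic = `[0, +oo[%classic.
Proof. by apply/seteqP; split => t /=; rewrite /shiftr !in_itv /=; lra. Qed.

Lemma integrable_hl_shift (f : R -> R) (h : R) : 0 <= h -> integrable_hl f ->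
  integrable_hl (fun t => f (t + h)).
Proof.
move=> h0 fi.
have fih : mu.-integrable `[h, +oo[ (EFin \o f).
  apply: integrableS fi => // t /=; rewrite !in_itv /=; lra.
have /integrableP[mf ify] := fih.
apply/integrableP; split.
  apply: (@measurable_comp _ _ _ _ _ _ `[h, +oo[ (EFin \o f) _ (shiftr h)) => //.
  - by rewrite -(preimage_shiftr h); exact: image_preimage_subset.
  - by apply: measurable_funS (measurable_shiftr h).
move: ify; rewrite (@eq_measure_integral _ _ _ _ (pushshift h)).
  rewrite (ge0_integral_pushforward (measurable_shiftr h)) //.
  - by rewrite preimage_shiftr.
  - exact: measurableT_comp.
by move=> A mA _; exact: lebesgue_measure_shift.
Qed.

Let integral_shift (f : R -> R) (h : R) : 0 <= h -> integrable_hl f ->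
  integral_hl (fun t => f (t + h)) = Rintegral mu `[h, +oo[ f.
Proof.
move=> h0 fi; rewrite /integral_hl /Rintegral; congr fine.
(* Extension by zero outside [[h, +oo[] gives a function measurable on the whole line, to which the
   change of variables applies. *)
pose g := (EFin \o f) \_ `[h, +oo[.
have fih : mu.-integrable `[h, +oo[ (EFin \o f).
  apply: integrableS fi => // t /=; rewrite !in_itv /=; lra.
have mg : measurable_fun setT g.
  by apply/(measurable_restrictT _ _).1 => //; case/integrableP : fih.
have gE t : t \in `[0, +oo[%classic -> (g \o shiftr h) t = (f (t + h))%:E.
  rewrite inE /= in_itv /= andbT => t0; rewrite /g patchE mem_set //=.
  by rewrite in_itv /= andbT /shiftr lerDr.
rewrite [RHS](@eq_measure_integral _ _ _ _ (pushshift h)); last first.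
  by move=> A mA _; exact: lebesgue_measure_shift.
transitivity (\int[pushshift h]_(x in `[h, +oo[) g x)%E; last first.
  by apply: eq_integral => t th; rewrite /g patchE th.
rewrite (integral_pushforward (measurable_shiftr h)) //; last first.
  rewrite preimage_shiftr; apply: eq_integrable (integrable_hl_shift h0 fi) => //.
  by move=> t t0; rewrite gE.
by rewrite preimage_shiftr; apply: eq_integral => t t0; rewrite gE.
Qed.

(** The difference of the two integrals is the integral of [f] over [[0, h]], compared here with the
    constant [c]. With [e] small this is a derivative at [0]; every differentiation of a half-line
    integral below goes through it. *)
Lemma integral_hl_shift_dist (f : R -> R) (h c e : R) : 0 <= h -> integrable_hl f ->
  (forall t, 0 <= t <= h -> `|f t - c| <= e) ->
  `|integral_hl f - integral_hl (fun t => f (t + h)) - h * c| <= h * e.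
Proof.
move=> h0 fi fc; rewrite integral_shift //.
have fih : mu.-integrable `[0, h] (EFin \o f).
  by apply: integrableS fi => // t /=; rewrite !in_itv /=; lra.
have fioh : mu.-integrable `]h, +oo[ (EFin \o f).
  by apply: integrableS fi => // t /=; rewrite !in_itv /=; lra.
have muh : fine (mu `[0, h]) = h.
  rewrite lebesgue_measure_itv /= lte_fin; case: ltrP => [_|] /=; lra.
have ci (k : R) : mu.-integrable `[0, h] (EFin \o (fun=> k)).
  apply: continuous_compact_integrable; first exact: segment_compact.
  exact/continuous_subspaceT/cst_continuous.
rewrite -Rintegral_itv_obnd_cbnd // -(@Rintegral_itvB _ _ (BLeft 0)) //.
rewrite /integral_hl opprB addrCA subrr addr0.
have cE (k : R) : h * k = \int[mu]_(_ in `[0, h]) k.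
  by rewrite Rintegral_cst // muh mulrC.
rewrite !cE -(RintegralB _ fih (ci c)) //.
have fci : mu.-integrable `[0, h] (EFin \o (fun t => f t - c)).
  rewrite (_ : _ \o _ = (EFin \o f) \- (EFin \o fun=> c))%E.
    apply: integrableB => //; exact: ci.
  by apply/funext.
apply: le_trans (le_normr_Rintegral _ fci) _ => //.
apply: le_Rintegral => //; first exact: (integrable_norm fci).
Qed.

(** The integrand is the exponential probability density of rate [c], which has mass 1 and vanishes
    on the negative half line. *)
Let integral_hl_expE (c : R) : 0 < c ->
  integrable_hl (fun t => c * expR (- (c * t))) /\
  integral_hl (fun t => c * expR (- (c * t))) = 1.
Proof.
move=> c0.
have E t : 0 <= t -> exponential_pdf c t = c * expR (- (c * t)).
  by move=> t0; rewrite exponential_pdfE // mulNr.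
have ei : integrable_hl (exponential_pdf c).
  by apply: integrableS (integrable_exponential_pdf c0).
split; first by apply: eq_integrable_hl ei.
rewrite -(eq_integral_hl E) /integral_hl /Rintegral.
have <- : fine (\int[mu]_x (exponential_pdf c x)%:E) = 1.
  by rewrite integral_exponential_pdf.
congr fine; rewrite [LHS]integral_mkcond; apply: eq_integral => t _.
rewrite patchE; case: ifPn => //; rewrite notin_setE /= in_itv /= andbT.
by move/negP; rewrite -ltNge => /lt0_exponential_pdf ->.
Qed.

Lemma integrable_hl_exp (K c : R) : 0 < c -> integrable_hl (fun t => K * expR (- (c * t))).
Proof.
move=> c0; have [ei _] := integral_hl_expE c0.
apply: eq_integrable_hl (integrable_hlZ (K / c) ei) => t _.
by field; rewrite gt_eqF.
Qed.

Lemma integral_hl_exp (K c : R) : 0 < c ->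
  integral_hl (fun t => K * expR (- (c * t))) = K / c.
Proof.
move=> c0; have [ei eE] := integral_hl_expE c0.
transitivity (integral_hl (fun t => K / c * (c * expR (- (c * t))))).
  by apply: eq_integral_hl => t _; field; rewrite gt_eqF.
by rewrite integral_hlZ // eE mulr1.
Qed.

Lemma le_norm_integral_hl_exp (f : R -> R) (K c : R) : 0 < c -> integrable_hl f ->
  (forall t, 0 <= t -> `|f t| <= K * expR (- (c * t))) -> `|integral_hl f| <= K / c.
Proof.
move=> c0 fi fK; apply: le_trans (le_normr_Rintegral _ fi) _ => //.
rewrite -integral_hl_exp //; apply: le_integral_hl => //; last exact: integrable_hl_exp.
exact: (integrable_norm fi).
Qed.

Lemma integral_hl_sum (T : Type) (s : seq T) (g : T -> R -> R) :
  (forall i, integrable_hl (g i)) ->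
  integrable_hl (fun t => \sum_(i <- s) g i t) /\
  integral_hl (fun t => \sum_(i <- s) g i t) = \sum_(i <- s) integral_hl (g i).
Proof.
move=> gi; elim: s => [|i s [IHi IHE]].
  have E t : 0 <= t -> 0 * expR (- (1 * t)) = \sum_(j <- [::]) g j t.
    by rewrite big_nil mul0r.
  split; first exact: eq_integrable_hl E (integrable_hl_exp 0 ltr01).
  by rewrite -(eq_integral_hl E) integral_hl_exp // mul0r big_nil.
have E t : 0 <= t -> g i t + \sum_(j <- s) g j t = \sum_(j <- i :: s) g j t.
  by rewrite big_cons.
split; first exact: eq_integrable_hl E (integrable_hlD (gi i) IHi).
by rewrite -(eq_integral_hl E) integral_hlD // IHE big_cons.
Qed.

(** Increments only go forward, with [d] uniform in [s]: this is the form that the semigroup law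
    provides. *)
Definition unif_continuous_hl (f : R -> R) : Prop := forall e, 0 < e ->
  exists2 d, 0 < d & forall s h, 0 <= s -> 0 <= h -> h < d -> `|f (s + h) - f s| < e.

(** The exponential is an integrable majorant. Measurability comes from continuity of the extension
    of [f] that is constant on the negative half line. *)
Lemma integrable_hl_unif_continuous (f : R -> R) (K c : R) : 0 < c ->
  unif_continuous_hl f -> (forall t, 0 <= t -> `|f t| <= K * expR (- (c * t))) ->
  integrable_hl f.
Proof.
move=> c0 fu fK; apply: le_integrable (integrable_hl_exp K c0) => //; last first.
  move=> t /=; rewrite in_itv /= andbT => t0; rewrite lee_fin.
  by apply: le_trans (fK _ t0) (ler_norm _).
apply/measurable_EFinP.
have mT : measurable_fun [set: R] (fun t : R => f (Num.max 0 t)).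
  apply: continuous_measurable_fun => t.
  apply/cvgrPdist_lt => e /fu[d d0 fd].
  have fab (a b : R) : 0 <= a -> a <= b -> `|b - a| < d -> `|f b - f a| < e.
    move=> a0 ab; rewrite ger0_norm ?subr_ge0 // => abd.
    have -> : b = a + (b - a) by ring.
    by apply: fd; rewrite ?subr_ge0.
  near=> s.
  have st : `|t - s| < d by near: s; apply: cvgr_dist_lt.
  have mst : `|Num.max 0 t - Num.max 0 s| <= `|t - s|.
    have ts := ler_norm (t - s); have := ler_norm (- (t - s)).
    by rewrite normrN => ts'; rewrite ler_norml !maxEle; do 2 case: ifPn; lra.
  have [le|/ltW le] := lerP (Num.max 0 s) (Num.max 0 t).
    by apply: fab le (le_lt_trans mst st); rewrite le_max lexx.
  rewrite distrC; apply: fab le _; first by rewrite le_max lexx.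
  by rewrite distrC (le_lt_trans mst).
have mm : measurable_fun (`[0, +oo[%classic : set (measurableTypeR R))
    (fun t : measurableTypeR R => f (Num.max 0 t)).
  exact: measurable_funTS.
apply: eq_measurable_fun mm => t; rewrite inE /= in_itv /= andbT => t0.
by rewrite max_r.
Unshelve. all: by end_near. Qed.

End HalfLineIntegral.

(** * The underlying real Hilbert space, generators and Riesz representation *)

Section RealHilbert.
Context {R : realType} {V : completeNormedModType R[i]}.
Variable ip : V -> V -> R[i].
Local Open Scope complex_scope.

(** The norm of [V] takes values in [R[i]]; its real part carries the same information in the
    totally ordered field [R]. *)
Definition nrm (x : V) : R := complex.Re `|x|.
Definition rip (x y : V) : R := complex.Re (ip x y).

Lemma normE (x : V) : `|x| = (nrm x)%:C.
Proof. by rewrite /nrm RRe_real // ger0_real. Qed.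

Lemma nrm_ge0 (x : V) : 0 <= nrm x.
Proof. by have := normr_ge0 x; rewrite normE lecR. Qed.

Lemma nrm_ltE (x : V) (e : R) : (`|x| < e%:C) = (nrm x < e).
Proof. by rewrite normE ltcR. Qed.

Lemma nrm_eq0 (x : V) : nrm x = 0 -> x = 0.
Proof. by move=> x0; apply/normr0_eq0; rewrite normE x0. Qed.

Lemma nrm0 : nrm 0 = 0.
Proof. by rewrite /nrm normr0. Qed.

Lemma nrmN (x : V) : nrm (- x) = nrm x.
Proof. by rewrite /nrm normrN. Qed.

Lemma nrmD (x y : V) : nrm (x + y) <= nrm x + nrm y.
Proof. by have := ler_normD x y; rewrite !normE -rmorphD lecR. Qed.

Lemma nrmB (x y : V) : nrm (x - y) <= nrm x + nrm y.
Proof. by rewrite -(nrmN y) nrmD. Qed.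

Lemma nrm_distC (x y : V) : nrm (x - y) = nrm (y - x).
Proof. by rewrite -nrmN opprB. Qed.

Lemma nrm_dist_triangle (z x y : V) : nrm (x - y) <= nrm (x - z) + nrm (z - y).
Proof. by rewrite (_ : x - y = (x - z) + (z - y)) ?nrmD // addrA subrK. Qed.

Lemma nrmZ (a : R) (x : V) : nrm (a%:C *: x) = `|a| * nrm x.
Proof.
rewrite /nrm normrZ normc_def /= expr0n /= addr0 sqrtr_sqr normE.
by rewrite -rmorphM.
Qed.

Lemma cvg0P (f : R -> V) (y : V) : f h @[h --> 0^'+] --> y <->
  forall e : R, 0 < e -> exists2 d, 0 < d &
    forall h, 0 < h -> h < d -> nrm (f h - y) < e.
Proof.
split=> [/cvgrPdist_lt fy e e0|fy].
  have [] := fy e%:C; first by rewrite ltcR.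
  move=> d /= d0 fd; exists d => // h h0 hd.
  rewrite nrm_distC -nrm_ltE; apply: fd => //=.
  by rewrite sub0r normrN gtr0_norm.
apply/cvgrPdist_lt => e e0.
have eE : e = (complex.Re e)%:C by rewrite RRe_real // gtr0_real.
move: e0; rewrite eE ltcR => /fy[d d0 fd]; exists d => //= h.
by rewrite /= sub0r normrN => hd h0; rewrite nrm_ltE nrm_distC fd // -(gtr0_norm h0).
Qed.

Lemma closureP (A : set V) (x : V) : closure A x <->
  forall e : R, 0 < e -> exists2 y, A y & nrm (x - y) < e.
Proof.
split=> [Ax e e0|Ax B].
  have [] := Ax (ball x e%:C); first by apply: nbhsx_ballx; rewrite ltcR.
  by move=> y [Ay]; rewrite -ball_normE /ball_ /= nrm_ltE => xy; exists y.
move=> /nbhs_ballP[e /= e0 eB].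
have eE : e = (complex.Re e)%:C by rewrite RRe_real // gtr0_real.
move: e0; rewrite eE ltcR => /Ax[y Ay xy]; exists y; split=> //.
by apply: eB; rewrite -ball_normE /ball_ /= eE nrm_ltE.
Qed.

Lemma nrm_complete (u : nat -> V) :
  (forall e : R, 0 < e -> exists N, forall m n, (N <= m)%N -> (N <= n)%N ->
     nrm (u m - u n) < e) ->
  exists l, forall e : R, 0 < e -> exists N, forall n, (N <= n)%N -> nrm (l - u n) < e.
Proof.
move=> cu.
have : cvg (u @ \oo).
  apply/cauchy_cvgP/cauchy_ballP => e e0.
  have eE : e = (complex.Re e)%:C by rewrite RRe_real // gtr0_real.
  move: e0; rewrite eE ltcR => /cu[N uN].
  pose B := [set u n | n in [set n | (N <= n)%N]].
  exists (B, B); first by split; exists N => // n /= Nn; exists n.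
  by move=> _ [/= [m mN <-] [n nN <-]]; rewrite -ball_normE /ball_ /= nrm_ltE; apply: uN.
move=> /cvg_ex[l /cvgrPdist_lt ul]; exists l => e e0.
have [] := ul e%:C; first by rewrite ltcR.
by move=> N _ uN; exists N => n /uN /=; rewrite nrm_ltE.
Qed.

Definition rlinear (T : V -> V) : Prop :=
  forall (a : R) x y, T (a%:C *: x + y) = a%:C *: T x + T y.

Lemma rlinear0 T : rlinear T -> T 0 = 0.
Proof.
move=> lT; have := lT 1 0 0; rewrite !scale1r addr0 => E.
by apply/(@addrI _ (T 0)); rewrite addr0 -E.
Qed.

Lemma rlinearD T x y : rlinear T -> T (x + y) = T x + T y.
Proof. by move=> lT; have := lT 1 x y; rewrite !scale1r. Qed.

Lemma rlinearZ T a x : rlinear T -> T (a%:C *: x) = a%:C *: T x.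
Proof. by move=> lT; have := lT a x 0; rewrite (rlinear0 lT) !addr0. Qed.

Lemma rlinearN T x : rlinear T -> T (- x) = - T x.
Proof.
by move=> lT; apply/eqP; rewrite -addr_eq0 -rlinearD // addNr rlinear0.
Qed.

Lemma rlinearB T x y : rlinear T -> T (x - y) = T x - T y.
Proof. by move=> lT; rewrite rlinearD // rlinearN. Qed.

Definition rbounded (K : R) (T : V -> V) : Prop := forall x, nrm (T x) <= K * nrm x.

Lemma bounded_op_rlinear T : bounded_op T -> rlinear T.
Proof. by move=> [lT _] a x y; rewrite lT. Qed.

Lemma bounded_op_rbounded T : bounded_op T -> exists2 K, 0 <= K & rbounded K T.
Proof.
move=> bT; have lT := bounded_op_rlinear bT; case: bT => _ cT.
have := cT 0 => /cvgrPdist_lt /(_ 1 ltr01)/nbhs_ballP[e /= e0].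
have eE : e = (complex.Re e)%:C by rewrite RRe_real // gtr0_real.
move: e0; rewrite eE ltcR; move: (complex.Re e) => d d0 dT.
exists (2 / d) => [|x]; first by rewrite divr_ge0 ?ltW.
have [/nrm_eq0 ->|x0] := eqVneq (nrm x) 0; first by rewrite rlinear0 // nrm0 mulr0.
have {}x0 : 0 < nrm x by rewrite lt_neqAle eq_sym x0 nrm_ge0.
(* Scaling by [k] brings [x] to norm [d / 2], strictly inside the ball where [T] has norm below
   1. *)
pose k := d / (2 * nrm x).
have k0 : 0 < k by rewrite divr_gt0 // mulr_gt0.
have : nrm (T (k%:C *: x)) < 1.
  rewrite -nrm_ltE; have := dT (k%:C *: x).
  rewrite (rlinear0 lT) sub0r normrN; apply.
  rewrite -ball_normE /ball_ /= sub0r normrN nrm_ltE nrmZ gtr0_norm //.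
  have -> : k * nrm x = d / 2 by rewrite /k; field; rewrite gt_eqF.
  by lra.
rewrite rlinearZ // nrmZ gtr0_norm // /k => H.
rewrite -(@ler_pM2l _ (d / (2 * nrm x))) // (_ : _ * (_ * _) = 1) ?ltW //.
by field; rewrite !gt_eqF.
Qed.

(** The limit defining the generator, multiplied through by [h]: the remainder is [o(h)] and no
    inverse occurs. *)
Definition gen_eps (S : R -> V -> V) (x b : V) : Prop :=
  forall e : R, 0 < e -> exists2 d, 0 < d &
    forall h, 0 < h -> h < d -> nrm (S h x - x - h%:C *: b) <= h * e.

Lemma gen_limP (S : R -> V -> V) (x b : V) : gen_lim S x b <-> gen_eps S x b.
Proof.
have E h : 0 < h -> nrm ((h^-1)%:C *: (S h x - x) - b) =
    h^-1 * nrm (S h x - x - h%:C *: b).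
  move=> h0; rewrite -[X in X * _](@gtr0_norm _ h^-1) ?invr_gt0 // -nrmZ.
  congr nrm; rewrite [RHS]scalerBr scalerA -rmorphM mulVf ?gt_eqF //.
  by rewrite scale1r.
split=> [/cvg0P Sx e /Sx[d d0 H]|Sx].
  exists d => // h h0 hd; have := H _ h0 hd; rewrite E // => /ltW.
  by rewrite mulrC ler_pdivrMr // mulrC.
apply/cvg0P => e e0; have [|d d0 H] := Sx (e / 2); first lra.
exists d => // h h0 hd; rewrite E // mulrC ltr_pdivrMr // mulrC.
by apply: le_lt_trans (H _ h0 hd) _; rewrite ltr_pM2l //; lra.
Qed.

Hypothesis ipP : is_inner_product ip.

Lemma ripDl x y z : rip (x + y) z = rip x z + rip y z.
Proof.
case: ipP => + _; move=> /(_ 1 x y z); rewrite /rip scale1r mul1r => ->.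
by rewrite raddfD.
Qed.

Lemma ripC x y : rip x y = rip y x.
Proof. by case: ipP => _ [+ _]; move=> /(_ x y); rewrite /rip => ->; case: (ip x y). Qed.

Lemma rip0l x : rip 0 x = 0.
Proof. by apply: (@addrI _ (rip 0 x)); rewrite -ripDl !addr0. Qed.

Lemma ripZl a x y : rip (a%:C *: x) y = a * rip x y.
Proof.
case: ipP => + _; move=> /(_ a%:C x 0 y); rewrite addr0 => H.
have := rip0l y; rewrite /rip H => E; rewrite raddfD /= E addr0.
by case: (ip x y) => u v /=; rewrite mul0r subr0.
Qed.

Lemma ripNl x y : rip (- x) y = - rip x y.
Proof. by apply/eqP; rewrite -addr_eq0 -ripDl addNr rip0l. Qed.

Lemma ripBl x y z : rip (x - y) z = rip x z - rip y z.
Proof. by rewrite ripDl ripNl. Qed.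

Lemma ripDr x y z : rip x (y + z) = rip x y + rip x z.
Proof. by rewrite ripC ripDl !(ripC x). Qed.

Lemma ripNr x y : rip x (- y) = - rip x y.
Proof. by rewrite ripC ripNl ripC. Qed.

Lemma ripBr x y z : rip x (y - z) = rip x y - rip x z.
Proof. by rewrite ripDr ripNr. Qed.

Lemma ripZr a x y : rip x (a%:C *: y) = a * rip x y.
Proof. by rewrite ripC ripZl ripC. Qed.

Lemma rip0r x : rip x 0 = 0.
Proof. by rewrite ripC rip0l. Qed.

Definition ripE := (ripDl, ripDr, ripNl, ripNr, ripZl, ripZr, rip0l, rip0r).

Lemma rip_nrm x : rip x x = nrm x ^+ 2.
Proof.
case: ipP => _ [_ /(_ x)]; rewrite /rip => ->; rewrite normE.
by rewrite -rmorphXn.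
Qed.

(** Turns imaginary parts into real ones: a complex identity follows from its real part tested on
    both [y] and ['i *: y]. *)
Lemma Im_ip x y : complex.Im (ip x y) = rip x ('i *: y).
Proof.
have [lip [cip _]] := ipP.
have E : ip 0 x = 0.
  by have := lip 1 0 0 x; rewrite scale1r mul1r addr0 => /(congr1 (fun z => z - ip 0 x));
  rewrite subrr addrK => <-.
rewrite ripC /rip; have := lip 'i y 0 x; rewrite addr0 E addr0 => ->.
by rewrite mulrC ReiNIm (cip x y); case: (ip x y) => u v; exact: (esym (opprK v)).
Qed.

Lemma rip_le x y : `|rip x y| <= nrm x * nrm y.
Proof.
have [/nrm_eq0 ->|y0] := eqVneq (nrm y) 0; first by rewrite rip0r normr0 nrm0 mulr0.
have {}y0 : 0 < nrm y by rewrite lt_neqAle eq_sym y0 nrm_ge0.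
(* This vector is the component of [x] orthogonal to [y], scaled by the square of [nrm y] to avoid a
   division. *)
have := sqr_ge0 (nrm ((nrm y ^+ 2)%:C *: x - (rip x y)%:C *: y)).
rewrite -(rip_nrm (_ - _)) !ripE !rip_nrm (ripC y x).
rewrite (_ : _ - _ - _ = nrm y ^+ 2 * ((nrm x * nrm y) ^+ 2 - rip x y ^+ 2)); last ring.
rewrite pmulr_rge0 ?exprn_gt0 // subr_ge0 => H.
by rewrite -ler_sqr ?nnegrE ?mulr_ge0 ?nrm_ge0 // real_normK ?num_real.
Qed.

Lemma rip_ext x z : (forall y, rip x y = rip z y) -> x = z.
Proof.
move=> xz; apply/eqP; rewrite -subr_eq0; apply/eqP/nrm_eq0/eqP.
by rewrite -sqrf_eq0 -rip_nrm ripBl xz subrr.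
Qed.

Lemma gen_eps_unique (S : R -> V -> V) (x b c : V) :
  gen_eps S x b -> gen_eps S x c -> b = c.
Proof.
move=> Sb Sc; apply/eqP; rewrite -subr_eq0; apply/eqP/nrm_eq0/eqP.
rewrite eq_le nrm_ge0 andbT leNgt; apply/negP => bc.
(* Two remainders of a quarter each bound [h * nrm (b - c)] by half of itself. *)
have e0 : 0 < nrm (b - c) / 4 by lra.
have [d d0 Hd] := Sb _ e0; have [d' d'0 Hd'] := Sc _ e0.
pose h := Num.min d d' / 2.
have [h0 hd hd'] : [/\ 0 < h, h < d & h < d'].
  have dd : 0 < Num.min d d' by rewrite lt_min d0.
  have d1 : Num.min d d' <= d by rewrite ge_min lexx.
  have d2 : Num.min d d' <= d' by rewrite ge_min lexx orbT.
  by split; rewrite /h; lra.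
have : nrm (h%:C *: (b - c)) <= h * (nrm (b - c) / 4) + h * (nrm (b - c) / 4).
  apply: le_trans (lerD (Hd' _ h0 hd') (Hd _ h0 hd)).
  rewrite -(nrmN (_ - _ *: b)); apply: le_trans (nrmD _ _).
  rewrite le_eqVlt; apply/orP; left; apply/eqP/(congr1 nrm).
  by apply: rip_ext => y; rewrite !ripE; ring.
rewrite nrmZ gtr0_norm //; nra.
Qed.

Lemma nrm_le x c : 0 <= c -> (forall y, `|rip x y| <= c * nrm y) -> nrm x <= c.
Proof.
move=> c0 /(_ x); rewrite rip_nrm ger0_norm ?sqr_ge0 //.
have := nrm_ge0 x; rewrite le_eqVlt => /predU1P[<- //|x0].
by rewrite expr2 ler_pM2r.
Qed.

Definition rclosed_subspace (E : V -> Prop) : Prop :=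
  [/\ E 0, forall (a : R) x y, E x -> E y -> E (a%:C *: x + y) &
   forall x, (forall e : R, 0 < e -> exists2 y, E y & nrm (x - y) < e) -> E x].

(* [p] minimises [|p|^2 - 2 phi p] over [E]; minimising sequences are Cauchy by
   the parallelogram identity. *)
Lemma riesz (E : V -> Prop) (phi : V -> R) (K : R) :
  rclosed_subspace E ->
  (forall a x y, phi (a%:C *: x + y) = a * phi x + phi y) ->
  (forall x, `|phi x| <= K * nrm x) ->
  exists2 p, E p & forall y, E y -> phi y = rip p y.
Proof.
move=> [E0 Elin Ecl] lphi bphi.
pose F x := nrm x ^+ 2 - 2 * phi x.
have phi0 : phi 0 = 0.
  by apply/eqP; rewrite -normr_le0; have := bphi 0; rewrite nrm0 mulr0.
have phiZ a x : phi (a%:C *: x) = a * phi x.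
  by have := lphi a x 0; rewrite !addr0 phi0 addr0.
have phiD x y : phi (x + y) = phi x + phi y.
  by have := lphi 1 x y; rewrite scale1r mul1r.
have F_ge x : - K ^+ 2 <= F x.
  have := bphi x; rewrite ler_norml => /andP[_ H]; rewrite /F.
  have := sqr_ge0 (nrm x - K); nra.
pose A : set R := [set F x | x in [set x | E x]].
have Ainf : has_inf A.
  by split; [exists (F 0), 0 | exists (- K ^+ 2) => _ [x _ <-]].
have Fi x : E x -> inf A <= F x.
  by move=> Ex; apply: ge_inf; [exact: (proj2 Ainf) | exists x].
have /choice[u Hu] n : exists x, E x /\ F x < inf A + n.+1%:R^-1.
  have [|_ [x Ex <-] xA] := inf_adherent (_ : 0 < n.+1%:R^-1) Ainf; last by exists x.
  by rewrite invr_gt0.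
have inv_small (e : R) : 0 < e -> exists N, forall n, (N <= n)%N -> n.+1%:R^-1 < e :> R.
  move=> e0; exists (Num.trunc e^-1).+1 => n nN.
  rewrite invf_plt ?posrE // (lt_le_trans (truncnS_gt _)) //.
  by rewrite ler_nat ltnW.
(* The parallelogram identity; the linear part of [F] cancels. *)
have par x y : nrm (x - y) ^+ 2 = 2 * F x + 2 * F y - 4 * F (2^-1%:C *: (x + y)).
  rewrite /F phiZ phiD -!rip_nrm !ripE (ripC y x); by field.
have [|p up] := @nrm_complete u.
  move=> e e0; have [|N HN] := inv_small (e ^+ 2 / 4); first by rewrite divr_gt0 ?exprn_gt0.
  exists N => m n mN nN; rewrite -ltr_sqr ?nnegrE ?nrm_ge0 ?ltW // par.
  have Em : E (2^-1%:C *: (u m + u n)).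
    rewrite scalerDr; apply: (Elin (2^-1)); first by case: (Hu m).
    by rewrite -[_ *: _]addr0; apply: (Elin (2^-1) _ _ _ E0); case: (Hu n).
  move: (Hu m).2 (Hu n).2 (HN _ mN) (HN _ nN) (Fi _ Em).
  by move: (F (u m)) (F (u n)) (F _) m.+1%:R^-1 n.+1%:R^-1 (e ^+ 2) (inf A) => *; lra.
exists p.
  by apply: Ecl => e /up[N HN]; exists (u N); [case: (Hu N) | exact: HN].
move=> y Ey.
(* First variation at the minimiser: the right side is [F (p + t y) - F p], and a quadratic in [t]
   without constant term is nonnegative only if its linear coefficient vanishes. *)
suff key t : 0 <= t ^+ 2 * nrm y ^+ 2 + 2 * t * (rip p y - phi y).
  set Y := nrm y ^+ 2 in key; have Y0 : 0 <= Y by exact: sqr_ge0.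
  set a := rip p y - phi y in key.
  suff : a = 0 by rewrite /a; lra.
  have Y1 : 0 < Y + 1 by lra.
  (* The minimum is at [- a / Y]; adding 1 also covers [y = 0]. *)
  have := key (- a / (Y + 1)).
  rewrite (_ : _ + _ = - (a ^+ 2 * (Y + 2) / (Y + 1) ^+ 2)); last first.
    by field; rewrite gt_eqF.
  rewrite oppr_ge0 pmulr_lle0 ?invr_gt0 ?exprn_gt0 // pmulr_lle0; last lra.
  by move=> a2; apply/eqP; rewrite -sqrf_eq0 eq_le a2 sqr_ge0.
(* The variation is taken at [u n] instead of [p]: the gap between [F (u n)] and the infimum costs
   [e / 2], and so does replacing [u n] by [p] in the linear term. *)
apply/ler_addgt0Pl => e e0; rewrite -lerBlDl sub0r.
have [|N HN] := inv_small (e / 2); first lra.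
pose c := 2 * (2 * `|t| * nrm y + 1).
have c0 : 0 < c.
  by rewrite /c; have := mulr_ge0 (normr_ge0 t) (nrm_ge0 y); nra.
have [|N' HN'] := up (e / c); first by rewrite divr_gt0.
pose n := maxn N N'.
have := HN n (leq_maxl _ _); have := HN' n (leq_maxr _ _).
have [En Fn] := Hu n.
have := Fi _ (Elin t _ _ Ey En); rewrite /F phiD phiZ.
rewrite -rip_nrm !ripE !rip_nrm => H1 H2 H3; move: Fn; rewrite /F => Fn.
have H4 : 2 * t * (rip (u n) y - rip p y) <= e / 2.
  apply: le_trans (ler_norm _) _; rewrite -ripBl normrM normrM ger0_norm //.
  have := rip_le (u n - p) y; rewrite nrm_distC.
  have ec : e / c * (2 * `|t| * nrm y) <= e / 2.
    rewrite mulrAC ler_pdivrMr // /c.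
    by have := mulr_ge0 (normr_ge0 t) (nrm_ge0 y); nra.
  move=> H5; apply: le_trans ec.
  have t0 := normr_ge0 t; have y0 := nrm_ge0 y.
  apply: (@le_trans _ _ (2 * `|t| * (nrm (p - u n) * nrm y))).
    by rewrite ler_wpM2l // mulr_ge0.
  rewrite (_ : _ * (_ * _) = nrm (p - u n) * (2 * `|t| * nrm y)); last by ring.
  by apply: ler_wpM2r (ltW H2); rewrite !mulr_ge0.
rewrite (ripC y (u n)) in H1; move: Fn H1 H3 H4.
move: (rip (u n) y) (rip p y) (phi y) (phi (u n)) (inf A) n.+1%:R^-1 (nrm y ^+ 2).
by move: (nrm (u n) ^+ 2) => *; lra.
Qed.

(** The Riesz representative in [E] of the pairing with [x] is the orthogonal projection of [x]; the
    residue is orthogonal to [E], hence zero. Both density arguments for the adjoint semigroup rest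
    on this. *)
Lemma closed_subspace_full (E : V -> Prop) : rclosed_subspace E ->
  (forall z, (forall y, E y -> rip z y = 0) -> z = 0) -> forall x, E x.
Proof.
move=> Ecl perp x.
have [|y|p Ep pE] := @riesz E (rip x) (nrm x) Ecl; last 1 first.
- suff -> : x = p by [].
  apply/eqP; rewrite -subr_eq0; apply/eqP/perp => y Ey.
  by rewrite ripBl pE // subrr.
- by move=> a y z; rewrite !ripE.
- exact: rip_le.
Qed.

End RealHilbert.

(** * Positive forms, orthonormal bases and partial traces *)

Section HilbertTrace.
Context {R : realType} {V : completeNormedModType R[i]}.
Variable ip : V -> V -> R[i].
Hypothesis ipP : is_inner_product ip.
Local Open Scope complex_scope.
Local Notation rp := (rip ip).
Local Notation rpE := (ripE ipP).

Definition rsym (Q : V -> V) : Prop := forall x y, rp (Q x) y = rp x (Q y).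
Definition rpsd (Q : V -> V) : Prop := forall x, 0 <= rp x (Q x).

Lemma psd_cauchy_schwarz Q x y : rlinear Q -> rsym Q -> rpsd Q ->
  rp x (Q y) ^+ 2 <= rp x (Q x) * rp y (Q y).
Proof.
move=> lQ sQ pQ.
have key s t : 0 <= s ^+ 2 * rp x (Q x) + 2 * s * t * rp x (Q y) + t ^+ 2 * rp y (Q y).
  have := pQ (s%:C *: x + t%:C *: y).
  rewrite lQ (rlinearZ _ _ lQ) !rpE -(sQ y x) (ripC ipP (Q y) x) => H.
  by apply: le_trans H _; rewrite le_eqVlt; apply/orP; left; apply/eqP; ring.
move: (pQ x) (pQ y) key; move: (rp x (Q x)) (rp x (Q y)) (rp y (Q y)) => a b c a0 c0 key.
have [c00|c00] := eqVneq c 0.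
  (* In the degenerate case these values make the quadratic equal to [- 2 b^2], which forces
     [b = 0]. *)
  by rewrite c00 mulr0; have := key (- b) (a / 2 + 1); rewrite c00; lra.
have c1 : 0 < c by rewrite lt_neqAle eq_sym c00.
have : 0 <= c * (a * c - b ^+ 2) by have := key c (- b); lra.
by rewrite pmulr_rge0 // subr_ge0.
Qed.

Lemma psd_kernel Q x : rlinear Q -> rsym Q -> rpsd Q -> rp x (Q x) <= 0 -> Q x = 0.
Proof.
move=> lQ sQ pQ qx; apply: (rip_ext ipP) => y; rewrite (rip0l ipP) (ripC ipP).
apply/eqP; rewrite -sqrf_eq0 eq_le sqr_ge0 andbT.
apply: le_trans (psd_cauchy_schwarz _ _ lQ sQ pQ) _.
by rewrite mulr_ge0_le0.
Qed.

(* Cholesky elimination: subtracting a rank-one form removes one vector from the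
   support of a positive form. *)
Lemma psd_elimination (s : seq V) (Q : V -> V) : rlinear Q -> rsym Q -> rpsd Q ->
  exists (vs : seq V) (Q' : V -> V),
    [/\ rlinear Q', rsym Q', rpsd Q', forall u, u \in s -> Q' u = 0 &
     forall x, rp x (Q x) = \sum_(v <- vs) rp x v ^+ 2 + rp x (Q' x)].
Proof.
elim: s Q => [|u s IH] Q lQ sQ pQ.
  by exists [::], Q; split=> // x; rewrite big_nil add0r.
(* For a zero pivot nothing is subtracted: the final [Q'] lies below [Q], so it already kills
   [u]. *)
have [q0|q0] := eqVneq (rp u (Q u)) 0.
  have [vs [Q' [lQ' sQ' pQ' Q's QE]]] := IH Q lQ sQ pQ.
  exists vs, Q'; split=> // w; rewrite in_cons => /predU1P[->|]; last exact: Q's.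
  apply: psd_kernel => //; have := QE u; rewrite q0 => /eqP.
  rewrite eq_sym addrC addr_eq0 => /eqP ->; rewrite oppr_le0.
  by apply: sumr_ge0 => v _; exact: sqr_ge0.
set q := rp u (Q u) in q0; have qp : 0 < q by rewrite lt_neqAle eq_sym q0 /q pQ.
(* A column of the Cholesky factor. [Q1] below is the Schur complement after pivoting on [u]: its
   form is zero at [u], and so is any positive form below it. *)
pose v := ((Num.sqrt q)^-1)%:C *: Q u.
have rv x : rp x v ^+ 2 = rp x (Q u) ^+ 2 / q.
  by rewrite /v (ripZr ipP) exprMn exprVn sqr_sqrtr ?ltW // mulrC.
pose Q1 x := Q x - (rp x (Q u) / q)%:C *: Q u.
have Q1E x y : rp x (Q1 y) = rp x (Q y) - rp x (Q u) * rp y (Q u) / q.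
  by rewrite /Q1 !rpE; ring.
have lQ1 : rlinear Q1.
  by move=> a x y; apply: (rip_ext ipP) => z; rewrite /Q1 lQ !rpE; ring.
have sQ1 : rsym Q1.
  by move=> x y; rewrite (ripC ipP) !Q1E -(sQ y x) (ripC ipP (Q y)); ring.
have pQ1 : rpsd Q1.
  move=> x; rewrite Q1E subr_ge0 ler_pdivrMr // -expr2.
  exact: psd_cauchy_schwarz.
have [vs [Q' [lQ' sQ' pQ' Q's QE]]] := IH Q1 lQ1 sQ1 pQ1.
exists (v :: vs), Q'; split=> // [w|x]; last first.
  by rewrite big_cons rv -addrA -QE Q1E; ring.
rewrite in_cons => /predU1P[->|]; last exact: Q's.
apply: psd_kernel => //; have := QE u; rewrite Q1E -/q mulfK // subrr => /eqP.
rewrite eq_sym addrC addr_eq0 => /eqP ->; rewrite oppr_le0.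
by apply: sumr_ge0 => z _; exact: sqr_ge0.
Qed.

Section Basis.
Variables (J : eqType) (f : J -> V).
Hypothesis fO : forall i j, rp (f i) (f j) = (i == j)%:R.

Let P (s : seq J) x := \sum_(i <- s) (rp x (f i))%:C *: f i.

Let rip_sumr x (s : seq J) (F : J -> V) : rp x (\sum_(i <- s) F i) = \sum_(i <- s) rp x (F i).
Proof.
by elim: s => [|i s IH]; rewrite ?big_nil ?(rip0r ipP) // !big_cons (ripDr ipP) IH.
Qed.

Let rip_P s x y : rp y (P s x) = \sum_(i <- s) rp x (f i) * rp y (f i).
Proof. by rewrite /P rip_sumr; apply: eq_bigr => i _; rewrite (ripZr ipP). Qed.

Let rip_P_f s x j : uniq s -> j \in s -> rp (P s x) (f j) = rp x (f j).
Proof.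
move=> us js; rewrite (ripC ipP) rip_P (bigD1_seq j) //= fO eqxx mulr1.
by rewrite big1 ?addr0 // => i ij; rewrite fO eq_sym (negPf ij) mulr0.
Qed.

Lemma dist_projection s x : uniq s ->
  nrm (x - P s x) ^+ 2 = nrm x ^+ 2 - \sum_(i <- s) rp x (f i) ^+ 2.
Proof.
move=> us; rewrite -!(rip_nrm ipP) !rpE (ripC ipP (P s x) x).
have -> : rp (P s x) (P s x) = rp x (P s x).
  rewrite !rip_P big_seq [RHS]big_seq; apply: eq_bigr => i iS.
  by rewrite rip_P_f.
rewrite (_ : \sum_(i <- s) _ = rp x (P s x)); first by ring.
by rewrite rip_P; apply: eq_bigr => i _; rewrite expr2.
Qed.

Lemma bessel s x : uniq s -> \sum_(i <- s) rp x (f i) ^+ 2 <= nrm x ^+ 2.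
Proof. by move=> us; rewrite -subr_ge0 -dist_projection // sqr_ge0. Qed.

Lemma sum_sqr_sub (s s' : seq J) (a : J -> R) : uniq s -> {subset s <= s'} ->
  \sum_(i <- s) a i ^+ 2 <= \sum_(i <- s') a i ^+ 2.
Proof.
move=> us ss'; elim: s s' us ss' => [|i s IH] s' /=.
  by move=> _ _; rewrite big_nil; apply: sumr_ge0 => i _; exact: sqr_ge0.
move=> /andP[iNs us] ss'.
have is' : i \in s' by apply: ss'; rewrite mem_head.
rewrite big_cons (perm_big _ (perm_to_rem is')) big_cons lerD2l.
apply: IH => // j js; have := ss' j; rewrite in_cons js orbT => /(_ isT).
by rewrite (perm_mem (perm_to_rem is')) in_cons => /predU1P[ji|//];
  rewrite -ji js in iNs.
Qed.

Hypothesis fD : forall x (e : R), 0 < e -> exists (s : seq J) (c : J -> R),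
  nrm (x - \sum_(i <- s) (c i)%:C *: f i) < e.

(** The projection onto finitely many [f i] fixes their combinations, so it is at least as close to
    [x] as the given combination. Duplicates are removed because the projection formula needs
    distinct indices. *)
Lemma parseval_approx x (e : R) : 0 < e ->
  exists2 s, uniq s & nrm x ^+ 2 - \sum_(i <- s) rp x (f i) ^+ 2 < e.
Proof.
move=> e0; have se0 : 0 < Num.sqrt e by rewrite sqrtr_gt0.
have [s0 [c sc]] := fD x se0; have us := undup_uniq s0.
exists (undup s0) => //; set s := undup s0 in us *.
set y := \sum_(i <- s0) _ in sc.
rewrite -dist_projection // -(sqr_sqrtr (ltW e0)).
rewrite ltr_sqr ?nnegrE ?nrm_ge0 ?sqrtr_ge0 //; apply: le_lt_trans sc.
suff -> : x - P s x = (x - y) - P s (x - y).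
  rewrite -ler_sqr ?nnegrE ?nrm_ge0 // dist_projection // gerBl.
  by apply: sumr_ge0 => i _; exact: sqr_ge0.
have PB u v : P s (u - v) = P s u - P s v.
  rewrite /P -sumrB; apply: eq_bigr => i _.
  by rewrite (ripBl ipP) rmorphB scalerBl.
suff Py : P s y = y by rewrite PB Py; apply: (rip_ext ipP) => z; rewrite !rpE; ring.
apply: (rip_ext ipP) => z; rewrite (ripC ipP) rip_P [RHS](ripC ipP) /y rip_sumr.
have yf i : rp y (f i) = \sum_(j <- s0) c j * (j == i)%:R.
  by rewrite (ripC ipP) /y rip_sumr; apply: eq_bigr => j _;
    rewrite (ripZr ipP) fO eq_sym.
rewrite -/y; under eq_bigr do rewrite yf mulr_suml.
rewrite exchange_big /= big_seq [RHS]big_seq; apply: eq_bigr => j js.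
rewrite (bigD1_seq j) ?mem_undup //= eqxx mulr1 (ripZr ipP) big1 ?addr0 // => i ij.
by rewrite eq_sym (negPf ij) mulr0 mul0r.
Qed.

(** Enlarging the index list only shrinks each defect, so the lists found for single vectors can be
    concatenated. *)
Lemma parseval_approx_seq (L : seq V) (e : R) : 0 < e ->
  exists2 s, uniq s & forall x, x \in L -> nrm x ^+ 2 - \sum_(i <- s) rp x (f i) ^+ 2 < e.
Proof.
move=> e0; elim: L => [|x L [s us sL]]; first by exists [::].
have [s' us' s'x] := parseval_approx x e0.
have U := undup_uniq (s ++ s').
exists (undup (s ++ s')) => // y; rewrite in_cons => /predU1P[->|yL].
  apply: le_lt_trans s'x; rewrite lerD2l lerN2.
  by apply: sum_sqr_sub => // i; rewrite mem_undup mem_cat orbC => ->.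
apply: le_lt_trans (sL y yL); rewrite lerD2l lerN2.
by apply: sum_sqr_sub => // i; rewrite mem_undup mem_cat => ->.
Qed.

(** Elimination along a long piece of the basis splits [Q] into squares of pairings with vectors [v]
    and a remainder [Q']. After exchanging sums, Bessel bounds the squares by the sum of
    [nrm (T v) ^+ 2], hence by [m ^+ 2] times that of [nrm v ^+ 2], which Parseval compares with
    [tr]. *)
Lemma trace_conj_le (Q T Ts : V -> V) (K m tr : R) : rlinear Q -> rsym Q -> rpsd Q ->
  0 <= K -> rbounded K Q -> 0 <= m -> (forall x y, rp (T x) y = rp x (Ts y)) -> rbounded m T ->
  (forall s, uniq s -> \sum_(i <- s) rp (f i) (Q (f i)) <= tr) ->
  forall s, uniq s -> \sum_(i <- s) rp (Ts (f i)) (Q (Ts (f i))) <= m ^+ 2 * tr.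
Proof.
move=> lQ sQ pQ K0 bQ m0 TTs bT trQ F uF; apply/ler_addgt0Pl => e e0.
(* Each of the [size F] remainder terms will cost at most [K * (e / k)]; the added 1 keeps [k]
   positive. *)
pose k := (size F)%:R * K + 1.
have k0 : 0 < k by rewrite /k ltr_wpDl // mulr_ge0.
have [|s us sF] := parseval_approx_seq [seq Ts (f i) | i <- F] (_ : 0 < e / k).
  by rewrite divr_gt0.
have [vs [Q' [lQ' sQ' pQ' Q's QE]]] := psd_elimination [seq f i | i <- s] lQ sQ pQ.
have Q'Q x : rp x (Q' x) <= rp x (Q x).
  by rewrite QE lerDr; apply: sumr_ge0 => v _; exact: sqr_ge0.
have Q'P x : Q' (P s x) = 0.
  rewrite /P big_seq; elim/big_rec: _ => [|i y iS]; first exact: (rlinear0 lQ').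
  by move=> y0; rewrite lQ' y0 addr0 Q's ?scaler0 // map_f.
have Q'le i : i \in F -> rp (Ts (f i)) (Q' (Ts (f i))) <= K * (e / k).
  move=> iF; set x := Ts (f i).
  (* [Q'] vanishes on the projection, so it only sees the component of [x] outside the chosen span,
     which is small by the choice of [s]. *)
  have -> : rp x (Q' x) = rp (x - P s x) (Q' (x - P s x)).
    rewrite (rlinearB _ _ lQ') Q'P subr0 (ripBl ipP).
    by rewrite -(sQ' (P s x)) Q'P (rip0l ipP) subr0.
  apply: le_trans (Q'Q _) _; apply: le_trans (ler_norm _) _.
  apply: le_trans (rip_le ipP _ _) _.
  apply: (@le_trans _ _ (K * nrm (x - P s x) ^+ 2)).
    by rewrite expr2 mulrCA ler_wpM2l ?nrm_ge0.
  by rewrite ler_wpM2l // dist_projection // ltW // sF // map_f.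
(* Each squared norm is expanded along the basis; exchanging the sums leaves a partial trace of
   squares lying below [Q]. *)
have vs_le : \sum_(v <- vs) nrm v ^+ 2 <= tr.
  apply/ler_addgt0Pl => e' e'0; pose n := (size vs)%:R + 1 : R.
  have n0 : 0 < n by rewrite /n ltr_wpDl.
  have [|s' us' s'v] := parseval_approx_seq vs (_ : 0 < e' / n); first by rewrite divr_gt0.
  have H1 : \sum_(v <- vs) nrm v ^+ 2 <=
      \sum_(v <- vs) (e' / n + \sum_(i <- s') rp v (f i) ^+ 2).
    rewrite big_seq [leRHS]big_seq; apply: ler_sum => v /s'v; rewrite ltrBlDr => /ltW.
    by [].
  apply: le_trans H1 _; rewrite big_split /= exchange_big /=.
  apply: lerD.
    rewrite big_const_seq count_predT iter_addr_0 -mulr_natl mulrCA ger_pMr //.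
    by rewrite ler_pdivrMr // mul1r /n lerDl.
  apply: le_trans (trQ s' us'); apply: ler_sum => i _; rewrite QE.
  rewrite (eq_bigr (fun v => rp (f i) v ^+ 2)) => [|v _]; last by rewrite (ripC ipP).
  by rewrite lerDl.
have -> : \sum_(i <- F) rp (Ts (f i)) (Q (Ts (f i))) =
    \sum_(v <- vs) \sum_(i <- F) rp (T v) (f i) ^+ 2 +
    \sum_(i <- F) rp (Ts (f i)) (Q' (Ts (f i))).
  rewrite exchange_big /= -big_split /=; apply: eq_bigr => i _; rewrite QE.
  by congr (_ + _); apply: eq_bigr => v _; rewrite (ripC ipP) TTs.
rewrite addrC; apply: lerD.
  apply: (@le_trans _ _ (\sum_(i <- F) K * (e / k))).
    by rewrite big_seq [leRHS]big_seq; apply: ler_sum => i /Q'le.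
  rewrite big_const_seq count_predT iter_addr_0 -mulr_natl.
  rewrite mulrA mulrCA ger_pMr // ler_pdivrMr // mul1r /k; lra.
apply: (@le_trans _ _ (\sum_(v <- vs) m ^+ 2 * nrm v ^+ 2)).
  apply: ler_sum => v _; apply: le_trans (bessel _ uF) _.
  by rewrite -exprMn lerXn2r ?nnegrE ?mulr_ge0 ?nrm_ge0.
by rewrite -mulr_sumr ler_wpM2l ?sqr_ge0.
Qed.

End Basis.

Lemma rip_iC x y : rp ('i *: x) y = - rp x ('i *: y).
Proof.
have [_ [cip _]] := ipP; rewrite (ripC ipP) -!(Im_ip ipP) (cip x y).
by case: (ip x y).
Qed.

Section ComplexBasis.
Variables (I : countType) (e : I -> V).
Hypothesis eB : orthonormal_basis ip e.

(* The underlying real Hilbert space has the orthonormal basis [e k], ['i *: e k]. *)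
Let f (p : I * bool) := if p.2 then 'i *: e p.1 else e p.1.

Let both (s : seq I) := [seq (i, false) | i <- s] ++ [seq (i, true) | i <- s].

Let ripii x y : rp ('i *: x) ('i *: y) = rp x y.
Proof.
by rewrite rip_iC scalerA -expr2 sqr_i scaleN1r (ripNr ipP) opprK.
Qed.

Let f_ortho i j : rp (f i) (f j) = (i == j)%:R.
Proof.
have [eO _] := eB.
have ReE k l : rp (e k) (e l) = (k == l)%:R by rewrite /rip eO; case: (k == l).
have ImE k l : rp (e k) ('i *: e l) = 0.
  by rewrite -(Im_ip ipP) eO; case: (k == l).
case: i j => [k b] [l c]; rewrite /f xpair_eqE /=; case: b; case: c.
- by rewrite ripii ReE andbT.
- by rewrite rip_iC ImE oppr0 andbF.
- by rewrite ImE andbF.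
- by rewrite ReE andbT.
Qed.

Let f_dense x (r : R) : 0 < r -> exists (s : seq (I * bool)) (c : I * bool -> R),
  nrm (x - \sum_(i <- s) (c i)%:C *: f i) < r.
Proof.
move=> r0; have [_ eD] := eB.
have : closure [set x | exists (s : seq I) (c : I -> R[i]),
    x = \sum_(i <- s) c i *: e i] x by rewrite eD.
move=> /closureP /(_ r r0)[_ [s [c ->]] xs].
exists (both s), (fun p => if p.2 then complex.Im (c p.1) else complex.Re (c p.1)).
rewrite /both big_cat !big_map /= -big_split /=.
rewrite (eq_bigr (fun i => c i *: e i)) // => i _.
by rewrite /f /= scalerA -scalerDl [in RHS](complexE (c i)) ['i * _]mulrC.
Qed.

(** In the real basis each diagonal term is counted twice, on [e k] and on ['i *: e k]. The factor 2
    appears on both sides of the real estimate and cancels. *)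
Lemma complex_trace_conj_le (Q T Ts : V -> V) (K m tr : R) :
  rlinear Q -> rsym Q -> rpsd Q -> 0 <= K -> rbounded K Q -> 0 <= m ->
  (forall x y, rp (T x) y = rp x (Ts y)) -> rbounded m T ->
  (forall x, Q ('i *: x) = 'i *: Q x) -> (forall x, Ts ('i *: x) = 'i *: Ts x) ->
  (forall s, uniq s -> \sum_(i <- s) rp (e i) (Q (e i)) <= tr) ->
  forall s, uniq s -> \sum_(i <- s) rp (Ts (e i)) (Q (Ts (e i))) <= m ^+ 2 * tr.
Proof.
move=> lQ sQ pQ K0 bQ m0 TTs bT Qi Tsi trQ s us.
have Qf p : rp (f p) (Q (f p)) = rp (e p.1) (Q (e p.1)).
  by rewrite /f; case: p.2; rewrite ?Qi ?ripii.
(* With the tag fixed, distinct pairs have distinct first components, so the hypothesis on [e]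
   applies. *)
have part (b : bool) (s' : seq (I * bool)) : uniq s' ->
    \sum_(p <- s' | p.2 == b) rp (f p) (Q (f p)) <= tr.
  move=> us'; rewrite -big_filter (eq_bigr _ (fun p _ => Qf p)).
  rewrite -(big_map fst xpredT (fun i => rp (e i) (Q (e i)))).
  apply: trQ; rewrite map_inj_in_uniq ?filter_uniq // => -[i a] [j a'].
  by rewrite !mem_filter /= => /andP[/eqP -> _] /andP[/eqP -> _] ->.
have trf s' : uniq s' -> \sum_(p <- s') rp (f p) (Q (f p)) <= 2 * tr.
  move=> us'; rewrite (bigID (fun p => p.2 == true)) /=.
  have E (p : I * bool) : ~~ (p.2 == true) = (p.2 == false) by case: p.2.
  rewrite (eq_bigl _ _ E).
  by have := part true s' us'; have := part false s' us'; lra.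
have uboth : uniq (both s).
  rewrite /both cat_uniq !map_inj_uniq ?us => [|i j [] //|i j [] //].
  rewrite andbT; apply/hasPn => _ /mapP[i _ ->].
  by apply/negP => /mapP[].
have := trace_conj_le f_ortho f_dense lQ sQ pQ K0 bQ m0 TTs bT trf uboth.
rewrite /both big_cat !big_map /f /=.
rewrite [X in _ + X](eq_bigr (fun i => rp (Ts (e i)) (Q (Ts (e i))))) => [|i _].
  by lra.
by rewrite Tsi Qi ripii.
Qed.

End ComplexBasis.
End HilbertTrace.

(** [esum] is a supremum over finite sets, so bounds on duplicate-free lists suffice whatever the
    signs of the terms. *)
Lemma esum_le_real (R : realType) (T : choiceType) (a : T -> R) (c : R) :
  (forall s, uniq s -> \sum_(i <- s) a i <= c) ->
  (\esum_(i in [set: T]) (a i)%:E <= c%:E)%E.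
Proof.
move=> ac; apply: ge_ereal_sup => _ [A [finA _] <-].
by rewrite fsbig_finite // sumEFin lee_fin ac.
Qed.

Lemma sum_le_esum (R : realType) (T : choiceType) (a : T -> R) (s : seq T) : uniq s ->
  ((\sum_(i <- s) a i)%:E <= \esum_(i in [set: T]) (a i)%:E)%E.
Proof.
move=> us; apply: esum_ge; exists [set` s]; first by split=> //; exact: finite_seq.
by rewrite -fsbig_seq // sumEFin.
Qed.

(** * The stable semigroup and its adjoint family *)

Section StableSemigroup.
Context {R : realType} {V : completeNormedModType R[i]}.
Variables (ip : V -> V -> R[i]) (S Ss : R -> V -> V) (M alpha : R).
Hypotheses (ipP : is_inner_product ip) (SC0 : C0_semigroup S).
Hypotheses (Sadj : adjoint_family ip S Ss) (M_gt0 : 0 < M) (alpha_gt0 : 0 < alpha).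
Hypothesis Sexp : exp_bound S M alpha.
Local Open Scope complex_scope.
Local Notation rp := (rip ip).
Local Notation rpE := (ripE ipP).

Let S_rlinear t : 0 <= t -> rlinear (S t).
Proof. by case: SC0 => bS _ /bS /bounded_op_rlinear. Qed.

Let S0 x : S 0 x = x.
Proof. by case: SC0 => _ [/(_ x)]. Qed.

Let SD s t x : 0 <= s -> 0 <= t -> S (s + t) x = S s (S t x).
Proof. by case: SC0 => _ [_ [+ _]] s0 t0; apply. Qed.

Let expR_le1 t : 0 <= t -> expR (- (alpha * t)) <= 1.
Proof. by move=> t0; rewrite -expR0 ler_expR oppr_le0 mulr_ge0 // ltW. Qed.

Lemma semigroup_nrm_exp t x : 0 <= t -> nrm (S t x) <= M * expR (- (alpha * t)) * nrm x.
Proof. by move=> t0; have := Sexp t0 x; rewrite !normE -rmorphM lecR. Qed.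

Let S_nrm t x : 0 <= t -> nrm (S t x) <= M * nrm x.
Proof.
move=> t0; apply: le_trans (semigroup_nrm_exp x t0) _; rewrite ler_wpM2r ?nrm_ge0 //.
by rewrite ger_pMr // expR_le1.
Qed.

Lemma semigroup_adj t x y : 0 <= t -> rp (S t x) y = rp x (Ss t y).
Proof. by move=> t0; rewrite /rip Sadj. Qed.

(** [Ss] is given only through the adjoint relation; its linearity, and below its bounds and
    semigroup law, come from moving operators across the inner product. *)
Lemma adj_rlinear t : 0 <= t -> rlinear (Ss t).
Proof.
move=> t0 a x y; apply: (rip_ext ipP) => z; rewrite (ripC ipP) -semigroup_adj //.
by rewrite !rpE !(ripC ipP _ z) -!semigroup_adj.
Qed.

Lemma adj_nrm_exp t x : 0 <= t -> nrm (Ss t x) <= M * expR (- (alpha * t)) * nrm x.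
Proof.
move=> t0; apply: (nrm_le ipP); first by rewrite !mulr_ge0 ?expR_ge0 ?nrm_ge0 ?ltW.
move=> y; rewrite (ripC ipP) -semigroup_adj // mulrAC.
apply: le_trans (rip_le ipP _ _) _; rewrite ler_wpM2r ?nrm_ge0 //.
exact: semigroup_nrm_exp.
Qed.

Lemma adj_nrm t x : 0 <= t -> nrm (Ss t x) <= M * nrm x.
Proof.
move=> t0; apply: le_trans (adj_nrm_exp x t0) _; rewrite ler_wpM2r ?nrm_ge0 //.
by rewrite ger_pMr // expR_le1.
Qed.

Lemma adj0 x : Ss 0 x = x.
Proof.
by apply: (rip_ext ipP) => y; rewrite (ripC ipP) -semigroup_adj // S0 (ripC ipP).
Qed.

Lemma adjD s t x : 0 <= s -> 0 <= t -> Ss (s + t) x = Ss s (Ss t x).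
Proof.
move=> s0 t0; apply: (rip_ext ipP) => y; rewrite !(ripC ipP _ y).
by rewrite -!semigroup_adj ?addr_ge0 // addrC SD.
Qed.

Definition strong_cont0 (T : R -> V -> V) (x : V) : Prop :=
  forall e : R, 0 < e -> exists2 d, 0 < d &
    forall h, 0 <= h -> h < d -> nrm (T h x - x) < e.

Lemma semigroup_strong_cont0 x : strong_cont0 S x.
Proof.
case: SC0 => _ [_ [_ /(_ x) /cvg0P Sx]] e e0; have [d d0 H] := Sx _ e0.
exists d => // h; rewrite le_eqVlt => /predU1P[<- _|]; last exact: H.
by rewrite S0 subrr nrm0.
Qed.

(** Continuity at [0] propagates to all times by the semigroup law and the uniform bound. The family
    is abstract so as to serve for both [S] and [Ss]. *)
Lemma semigroup_unif (T : R -> V -> V) x :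
  (forall t, 0 <= t -> rlinear (T t)) ->
  (forall t y, 0 <= t -> nrm (T t y) <= M * nrm y) ->
  (forall s t y, 0 <= s -> 0 <= t -> T (s + t) y = T s (T t y)) ->
  strong_cont0 T x -> forall e : R, 0 < e -> exists2 d, 0 < d &
    forall s h, 0 <= s -> 0 <= h -> h < d -> nrm (T (s + h) x - T s x) < e.
Proof.
move=> lT bT TD cT e e0; have [|d d0 H] := cT (e / M); first by rewrite divr_gt0.
exists d => // s h s0 h0 hd; rewrite TD // -(rlinearB _ _ (lT s s0)).
apply: le_lt_trans (bT _ _ s0) _.
by rewrite mulrC -ltr_pdivlMr // H.
Qed.

Let orbit_integrable x y : integrable_hl (fun t => rp x (S t y)).
Proof.
apply: (@integrable_hl_unif_continuous _ _ (nrm x * (M * nrm y)) alpha) => //.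
  move=> e e0.
  have [||||d d0 H] := @semigroup_unif S y _ _ _ (semigroup_strong_cont0 y) (e / (nrm x + 1)).
  - exact: S_rlinear.
  - by move=> *; exact: S_nrm.
  - by move=> *; exact: SD.
  - by rewrite divr_gt0 // ltr_wpDl // nrm_ge0.
  exists d => // s h s0 h0 hd; rewrite -(ripBr ipP).
  apply: le_lt_trans (rip_le ipP _ _) _.
  have x1 : 0 < nrm x + 1 by rewrite ltr_wpDl // nrm_ge0.
  have := H s h s0 h0 hd; rewrite ltr_pdivlMr // mulrC => H1.
  apply: le_lt_trans H1.
  by rewrite ler_wpM2r ?nrm_ge0 // lerDl.
move=> t t0; apply: le_trans (rip_le ipP _ _) _; rewrite -!mulrA.
rewrite ler_wpM2l ?nrm_ge0 //; have := semigroup_nrm_exp y t0.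
by rewrite [nrm y * _]mulrC mulrA.
Qed.

(* The operator [Z], minus the inverse of the generator of [Ss], is the weakly defined
   integral of [Ss t] over the half line; it makes the domain of that generator dense. *)
Let Zex : exists Z : V -> V, forall x y,
  rp (Z x) y = integral_hl (fun t => rp x (S t y)).
Proof.
suff /choice[Z HZ] x : exists z, forall y, rp z y = integral_hl (fun t => rp x (S t y)).
  by exists Z.
have [|||z _ Hz] := @riesz _ _ ip ipP (fun=> True)
  (fun y => integral_hl (fun t => rp x (S t y))) (nrm x * M / alpha).
- by split.
- move=> a y z; rewrite -integral_hlZ // -integral_hlD //; last exact: integrable_hlZ.
  by apply: eq_integral_hl => t t0; rewrite S_rlinear // !rpE.
- move=> y; rewrite mulrAC; apply: le_norm_integral_hl_exp => // t t0.
  apply: le_trans (rip_le ipP _ _) _; rewrite -!mulrA.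
  rewrite ler_wpM2l ?nrm_ge0 //; have := semigroup_nrm_exp y t0.
  by rewrite [nrm y * _]mulrC mulrA.
- by exists z => y; rewrite Hz.
Qed.

Let Z := projT1 (cid Zex).
Let ZE x y : rp (Z x) y = integral_hl (fun t => rp x (S t y)).
Proof. exact: (projT2 (cid Zex)). Qed.

Let ZSsE h x y : 0 <= h ->
  rp (Ss h (Z x)) y = integral_hl (fun t => rp x (S (t + h) y)).
Proof.
move=> h0; rewrite (ripC ipP) -semigroup_adj // (ripC ipP) ZE.
by apply: eq_integral_hl => t t0; rewrite SD.
Qed.

(** Applying [Ss h] to [Z x] shifts the integrand by [h], so [Z x - Ss h (Z x)] is a weak integral
    over [[0, h]]. *)
Let Z_dist (h c e : R) x y : 0 <= h ->
  (forall t, 0 <= t <= h -> `|rp x (S t y) - c| <= e) ->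
  `|rp (Z x) y - rp (Ss h (Z x)) y - h * c| <= h * e.
Proof.
by move=> h0 H; rewrite ZE ZSsE //; apply: integral_hl_shift_dist.
Qed.

Let SsZ h x : 0 <= h -> Ss h (Z x) = Z (Ss h x).
Proof.
move=> h0; apply: (rip_ext ipP) => y; rewrite ZSsE // ZE.
apply: eq_integral_hl => t t0.
by rewrite (ripC ipP (Ss h x)) -semigroup_adj // (ripC ipP) addrC SD.
Qed.

Let Z_rlinear : rlinear Z.
Proof.
move=> a x y; apply: (rip_ext ipP) => z; rewrite !rpE !ZE -integral_hlZ //.
rewrite -integral_hlD //; last exact: integrable_hlZ.
by apply: eq_integral_hl => t t0; rewrite !rpE.
Qed.

(** The increment is a weak integral of a bounded function over [[0, h]], hence of order [h]. *)
Let Z_strong_cont0 x : strong_cont0 Ss (Z x).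
Proof.
move=> e e0; pose k := M * nrm x.
have k0 : 0 <= k by rewrite mulr_ge0 ?nrm_ge0 ?ltW.
exists (e / (k + 1)); first by rewrite divr_gt0 //; lra.
move=> h h0; rewrite ltr_pdivlMr => [hk|]; last lra.
apply: (@le_lt_trans _ _ (h * k)); last by nra.
apply: (nrm_le ipP) => [|y]; first by rewrite mulr_ge0.
have := @Z_dist h 0 (k * nrm y) x y h0; rewrite mulr0 subr0 mulrA => H.
rewrite (ripBl ipP) distrC; apply: H => t /andP[t0 _]; rewrite subr0.
apply: le_trans (rip_le ipP _ _) _; rewrite /k mulrAC mulrC.
by rewrite ler_wpM2r ?nrm_ge0 // S_nrm.
Qed.

(** [Z] commutes with [Ss h], so [w] is orthogonal to the increments [Z x - Ss h (Z x)] too; divided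
    by [h], their pairings with [w] tend to [rp x w]. Thus the range of [Z] is dense. *)
Let Z_perp w : (forall x, rp (Z x) w = 0) -> w = 0.
Proof.
move=> Zw; apply: (rip_ext ipP) => x; rewrite (rip0l ipP) (ripC ipP).
apply/eqP; rewrite -normr_le0; apply/ler_addgt0Pl => e e0; rewrite addr0.
have x1 : 0 < nrm x + 1 by rewrite ltr_wpDl // nrm_ge0.
have [|d d0 H] := @semigroup_strong_cont0 w (e / (nrm x + 1)); first by rewrite divr_gt0.
have h0 : 0 < d / 2 by lra.
have := @Z_dist (d / 2) (rp x w) e x w (ltW h0).
rewrite (SsZ _ (ltW h0)) !Zw subrr sub0r normrN normrM gtr0_norm // ler_pM2l //.
apply => t /andP[t0 td]; rewrite -(ripBr ipP).
apply: le_trans (rip_le ipP _ _) _; rewrite mulrC.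
have := H t t0; rewrite ltr_pdivlMr // => /(_ ltac:(lra)) H1.
by have := nrm_ge0 (S t w - w); nra.
Qed.

(** By the uniform bound on [Ss], the vectors with this property form a closed subspace; it contains
    the dense range of [Z]. *)
Lemma adj_strong_cont0 x : strong_cont0 Ss x.
Proof.
apply: (closed_subspace_full ipP) => [|z zE]; last first.
  by apply: Z_perp => y; rewrite (ripC ipP); apply: zE; exact: Z_strong_cont0.
split.
- move=> e e0; exists 1 => // h h0 _.
  by rewrite (rlinear0 (adj_rlinear h0)) subrr nrm0.
- move=> a u v cu cv e e0.
  have a1 : 0 < 2 * (`|a| + 1) by rewrite mulr_gt0 // ltr_wpDl.
  have [|d d0 Hd] := cu (e / (2 * (`|a| + 1))); first by rewrite divr_gt0.
  have [|d' d'0 Hd'] := cv (e / 2); first lra.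
  exists (Num.min d d'); first by rewrite lt_min d0.
  move=> h h0; rewrite lt_min => /andP[hd hd'].
  have -> : Ss h (a%:C *: u + v) - (a%:C *: u + v) =
      a%:C *: (Ss h u - u) + (Ss h v - v).
    by rewrite adj_rlinear // scalerBr opprD addrACA.
  apply: le_lt_trans (nrmD _ _) _; rewrite nrmZ.
  have := Hd _ h0 hd; rewrite ltr_pdivlMr // => H1; have H2 := Hd' _ h0 hd'.
  by have := nrm_ge0 (Ss h u - u); have := normr_ge0 a; nra.
- move=> u cu e e0.
  have M1 : 0 < 2 * (M + 1) by rewrite mulr_gt0 // addr_gt0.
  have [|v cv uv] := cu (e / (2 * (M + 1))); first by rewrite divr_gt0.
  have [|d d0 Hd] := cv (e / 2); first lra.
  exists d => // h h0 hd.
  have -> : Ss h u - u = (Ss h (u - v) - (u - v)) + (Ss h v - v).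
    rewrite (rlinearB _ _ (adj_rlinear h0)); apply: (rip_ext ipP) => y.
    by rewrite !rpE; ring.
  apply: le_lt_trans (nrmD _ _) _.
  have H1 := nrmB (Ss h (u - v)) (u - v); have H2 := adj_nrm (u - v) h0.
  have H3 := Hd _ h0 hd; move: uv; rewrite ltr_pdivlMr // => uv; nra.
Qed.

Lemma adj_unif x (e : R) : 0 < e -> exists2 d, 0 < d &
  forall s h, 0 <= s -> 0 <= h -> h < d -> nrm (Ss (s + h) x - Ss s x) < e.
Proof.
apply: semigroup_unif; [exact: adj_rlinear|by move=> *; exact: adj_nrm| |].
  by move=> *; exact: adjD.
exact: adj_strong_cont0.
Qed.

(** Strong continuity of [Ss] at [x] makes the weak integral over [[0, h]] equal to [h x] up to
    [o(h)]. *)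
Let Z_gen x : gen_eps Ss (Z x) (- x).
Proof.
move=> e e0; have [d d0 H] := adj_strong_cont0 x e0.
exists d => // h h0 hd; apply: (nrm_le ipP) => [|y]; first by rewrite mulr_ge0 ?ltW.
have := @Z_dist h (rp x y) (e * nrm y) x y (ltW h0); rewrite mulrA.
have -> : rp (Ss h (Z x) - Z x - h%:C *: - x) y =
    - (rp (Z x) y - rp (Ss h (Z x)) y - h * rp x y) by rewrite !rpE; ring.
rewrite normrN; apply => t /andP[t0 th].
have -> : rp x (S t y) - rp x y = rp (Ss t x - x) y.
  by rewrite (ripC ipP) semigroup_adj // (ripC ipP) !rpE.
apply: le_trans (rip_le ipP _ _) _.
by rewrite ler_wpM2r ?nrm_ge0 // ltW // H // (le_lt_trans th).
Qed.

Lemma adj_dom_dense x (e : R) : 0 < e ->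
  exists y b, gen_eps Ss y b /\ nrm (x - y) < e.
Proof.
suff /(_ x e) H : forall x e, 0 < e -> exists2 p, True & nrm (x - Z p) < e.
  by move=> /H[p _ xp]; exists (Z p), (- p); split=> //; exact: Z_gen.
move=> {}x; apply: (closed_subspace_full ipP (E := fun x => forall e : R, 0 < e ->
  exists2 p, True & nrm (x - Z p) < e)) => [|z zE]; last first.
  apply: Z_perp => y; rewrite (ripC ipP); apply: zE => {}e e0.
  by exists y => //; rewrite subrr nrm0.
split.
- by move=> {}e e0; exists 0 => //; rewrite (rlinear0 Z_rlinear) subrr nrm0.
- move=> a u v cu cv {}e e0.
  have a1 : 0 < 2 * (`|a| + 1) by rewrite mulr_gt0 // ltr_wpDl.
  have [|p _ up] := cu (e / (2 * (`|a| + 1))); first by rewrite divr_gt0.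
  have [|q _ vq] := cv (e / 2); first lra.
  exists (a%:C *: p + q) => //.
  have -> : a%:C *: u + v - Z (a%:C *: p + q) = a%:C *: (u - Z p) + (v - Z q).
    by rewrite Z_rlinear // scalerBr opprD addrACA.
  apply: le_lt_trans (nrmD _ _) _; rewrite nrmZ.
  move: up; rewrite ltr_pdivlMr // => H1.
  by have := nrm_ge0 (u - Z p); have := normr_ge0 a; nra.
- move=> u cu {}e e0.
  have [|v cv uv] := cu (e / 2); first lra.
  have [|p _ vp] := cv (e / 2); first lra.
  exists p => //; apply: le_lt_trans (nrm_dist_triangle v _ _) _; lra.
Qed.

Lemma conj_semigroup_cont (W : V -> V) (K : R) x : rlinear W -> rbounded K W -> 0 <= K ->
  forall e : R, 0 < e -> exists2 d, 0 < d &
    forall t, 0 <= t -> t < d -> nrm (S t (W (Ss t x)) - W x) < e.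
Proof.
move=> lW bW K0 e e0.
have k0 : 0 < 2 * (M * K + 1) by have := mulr_ge0 (ltW M_gt0) K0; lra.
have [|d d0 Hd] := @adj_strong_cont0 x (e / (2 * (M * K + 1))); first by rewrite divr_gt0.
have [|d' d'0 Hd'] := @semigroup_strong_cont0 (W x) (e / 2); first by lra.
exists (Num.min d d'); first by rewrite lt_min d0.
move=> t t0; rewrite lt_min => /andP[td td'].
have -> : S t (W (Ss t x)) - W x = S t (W (Ss t x - x)) + (S t (W x) - W x).
  rewrite (rlinearB _ _ lW) (rlinearB _ _ (S_rlinear t0)).
  by apply: (rip_ext ipP) => y; rewrite !rpE; ring.
apply: le_lt_trans (nrmD _ _) _.
have H1 := S_nrm (W (Ss t x - x)) t0; have H2 := bW (Ss t x - x).
have H3 := Hd' _ t0 td'; have := Hd _ t0 td; rewrite ltr_pdivlMr // => H4.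
have H5 := nrm_ge0 (Ss t x - x).
have H6 : M * nrm (W (Ss t x - x)) <= M * (K * nrm (Ss t x - x)) by rewrite ler_pM2l.
by nra.
Qed.

(* Shifting the integral by [h] gives [S h X Ss h = X - \int_0^h S t W (Ss t) dt]; the
   estimates are tested against a vector so that only scalar integrals occur. *)
Lemma lyapunov_generator (W X : V -> V) (Kw Kx : R) x b :
  rlinear W -> rbounded Kw W -> 0 <= Kw -> rlinear X -> rbounded Kx X -> 0 <= Kx ->
  (forall x y, integrable_hl (fun t => rp (S t (W (Ss t x))) y) /\
     rp (X x) y = integral_hl (fun t => rp (S t (W (Ss t x))) y)) ->
  gen_eps Ss x b -> gen_eps S (X x) (- W x - X b).
Proof.
move=> lW bW Kw0 lX bX Kx0 XE xb e e0.
have k0 : 0 < 3 * (M * Kx + 1) by have := mulr_ge0 (ltW M_gt0) Kx0; lra.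
have [|d1 d10 H1] := @conj_semigroup_cont W Kw x lW bW Kw0 (e / 3); first lra.
have [|d2 d20 H2] := xb (e / (3 * (M * Kx + 1))); first by rewrite divr_gt0.
have [|d3 d30 H3] := @semigroup_strong_cont0 (X b) (e / 3); first lra.
exists (Num.min d1 (Num.min d2 d3)); first by rewrite !lt_min d10 d20.
move=> h h0; rewrite !lt_min => /and3P[hd1 hd2 hd3].
have h0' := ltW h0; have {}H2 := H2 _ h0 hd2; have {}H3 := H3 _ h0' hd3.
have H4 : nrm (S h (X (Ss h x)) - X x + h%:C *: W x) <= h * (e / 3).
  apply: (nrm_le ipP) => [|y]; first by rewrite mulr_ge0 ?ltW // divr_gt0.
  have [fi fE] := XE x y.
  have := @integral_hl_shift_dist _ _ h (rp (W x) y) (e / 3 * nrm y) (ltW h0) fi.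
  rewrite -fE (_ : integral_hl _ = rp (S h (X (Ss h x))) y); last first.
    rewrite semigroup_adj //; have [_ ->] := XE (Ss h x) (Ss h y).
    apply: eq_integral_hl => t t0; rewrite -semigroup_adj // -SD // -adjD //.
    by rewrite [h + t]addrC.
  have -> : rp (S h (X (Ss h x)) - X x + h%:C *: W x) y =
      - (rp (X x) y - rp (S h (X (Ss h x))) y - h * rp (W x) y).
    by rewrite !rpE; ring.
  rewrite normrN mulrA; apply => t /andP[t0 th]; rewrite -(ripBl ipP).
  apply: le_trans (rip_le ipP _ _) _.
  by rewrite ler_wpM2r ?nrm_ge0 // ltW // H1 // (le_lt_trans th).
(* Comparison through [S h (X (Ss h x))]: the first bracket is the shifted integral, the second the
   remainder of [Ss h x] under a bounded operator, the third the continuity of [S] at [X b]. Each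
   costs [h * (e / 3)]. *)
have -> : S h (X x) - X x - h%:C *: (- W x - X b) =
    (S h (X (Ss h x)) - X x + h%:C *: W x) - S h (X (Ss h x - x - h%:C *: b))
    - h%:C *: (S h (X b) - X b).
  rewrite !(rlinearB _ _ lX) (rlinearZ _ _ lX).
  rewrite !(rlinearB _ _ (S_rlinear (ltW h0))) (rlinearZ _ _ (S_rlinear (ltW h0))).
  by apply: (rip_ext ipP) => y; rewrite !rpE; ring.
apply: le_trans (nrmB _ _) _; rewrite nrmZ gtr0_norm //.
have H5 := nrmB (S h (X (Ss h x)) - X x + h%:C *: W x) (S h (X (Ss h x - x - h%:C *: b))).
have H6 : nrm (S h (X (Ss h x - x - h%:C *: b))) <= h * (e / 3).
  apply: le_trans (S_nrm _ (ltW h0)) _.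
  apply: (@le_trans _ _ (M * (Kx * nrm (Ss h x - x - h%:C *: b)))).
    by rewrite ler_pM2l.
  have := nrm_ge0 (Ss h x - x - h%:C *: b).
  have : nrm (Ss h x - x - h%:C *: b) * (3 * (M * Kx + 1)) <= h * e.
    by rewrite -ler_pdivlMr // -mulrA.
  by have := mulr_ge0 (ltW M_gt0) Kx0; nra.
have H7 : h * nrm (S h (X b) - X b) <= h * (e / 3) by rewrite ler_pM2l // ltW.
by lra.
Qed.

Lemma adj_gen_orbit t x b : 0 <= t -> gen_eps Ss x b -> gen_eps Ss (Ss t x) (Ss t b).
Proof.
move=> t0 xb e e0; have [|d d0 H] := xb (e / M); first by rewrite divr_gt0.
exists d => // h h0 hd; have h0' := ltW h0; rewrite -adjD // [h + t]addrC adjD //.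
rewrite -(rlinearB _ _ (adj_rlinear t0)) -(rlinearZ _ _ (adj_rlinear t0)).
rewrite -(rlinearB _ _ (adj_rlinear t0)); apply: le_trans (adj_nrm _ t0) _.
by rewrite mulrC -ler_pdivlMr // -mulrA H.
Qed.

(** Both difference quotients are taken at the same [h], where the adjoint relation cancels
    everything except the two remainders. *)
Lemma gen_adj x y a b : gen_eps S x a -> gen_eps Ss y b -> rp a y = rp x b.
Proof.
move=> xa yb; apply/eqP; rewrite -subr_eq0 -normr_le0; apply/ler_addgt0Pl => e e0.
rewrite addr0; pose k := nrm x + nrm y + 1.
have k0 : 0 < k by have := nrm_ge0 x; have := nrm_ge0 y; rewrite /k; lra.
have [|d d0 Hd] := xa (e / k); first by rewrite divr_gt0.
have [|d' d'0 Hd'] := yb (e / k); first by rewrite divr_gt0.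
pose h := Num.min d d' / 2.
have [h0 hd hd'] : [/\ 0 < h, h < d & h < d'].
  have dd : 0 < Num.min d d' by rewrite lt_min d0.
  have d1 : Num.min d d' <= d by rewrite ge_min lexx.
  have d2 : Num.min d d' <= d' by rewrite ge_min lexx orbT.
  by split; rewrite /h; lra.
rewrite -(@ler_pM2l _ h) // -[X in X * _](gtr0_norm h0) -normrM.
have -> : h * (rp a y - rp x b) =
    rp x (Ss h y - y - h%:C *: b) - rp (S h x - x - h%:C *: a) y.
  by rewrite !rpE semigroup_adj; [ring | exact: ltW].
apply: le_trans (ler_normB _ _) _.
have H1 := rip_le ipP x (Ss h y - y - h%:C *: b).
have H2 := rip_le ipP (S h x - x - h%:C *: a) y.
have H3 := Hd _ h0 hd; have H4 := Hd' _ h0 hd'.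
have x0 := nrm_ge0 x; have y0 := nrm_ge0 y.
have H5 : nrm x * nrm (Ss h y - y - h%:C *: b) <= nrm x * (h * (e / k)).
  by rewrite ler_wpM2l.
have H6 : nrm (S h x - x - h%:C *: a) * nrm y <= (h * (e / k)) * nrm y.
  by rewrite ler_wpM2r.
have H7 : h * e = (h * (e / k)) * (nrm x + nrm y + 1).
  by rewrite -/k; field; rewrite gt_eqF.
have H8 : 0 <= h * (e / k) by rewrite mulr_ge0 ?ltW // divr_gt0.
by rewrite H7; move: (h * (e / k)) H5 H6 H8 => z *; lra.
Qed.

(** * Bounded real bilinear forms along adjoint orbits *)

Definition bounded_form (C : R) (B : V -> V -> R) : Prop :=
  [/\ forall a x x' y, B (a%:C *: x + x') y = a * B x y + B x' y,
      forall a x y y', B x (a%:C *: y + y') = a * B x y + B x y' &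
      forall x y, `|B x y| <= C * nrm x * nrm y].

Section BoundedForm.
Variables (B : V -> V -> R) (C : R).
Hypotheses (C_ge0 : 0 <= C) (BP : bounded_form C B).

Let BDl x x' y : B (x + x') y = B x y + B x' y.
Proof. by case: BP => /(_ 1 x x' y) + _ _; rewrite scale1r mul1r. Qed.

Let B0l y : B 0 y = 0.
Proof. by apply: (@addrI _ (B 0 y)); rewrite -BDl !addr0. Qed.

Let BZl a x y : B (a%:C *: x) y = a * B x y.
Proof. by case: BP => /(_ a x 0 y) + _ _; rewrite B0l !addr0. Qed.

Let BNl x y : B (- x) y = - B x y.
Proof. by apply/eqP; rewrite -addr_eq0 -BDl addNr B0l. Qed.

Let BDr x y y' : B x (y + y') = B x y + B x y'.
Proof. by case: BP => _ /(_ 1 x y y') + _; rewrite scale1r mul1r. Qed.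

Let B0r y : B y 0 = 0.
Proof. by apply: (@addrI _ (B y 0)); rewrite -BDr !addr0. Qed.

Let BZr a x y : B x (a%:C *: y) = a * B x y.
Proof. by case: BP => _ /(_ a x y 0) + _; rewrite B0r !addr0. Qed.

Let BNr x y : B x (- y) = - B x y.
Proof. by apply/eqP; rewrite -addr_eq0 -BDr addNr B0r. Qed.

Let BE := (BDl, BDr, BZl, BZr, BNl, BNr).

Let B_le x y c d : nrm x <= c -> nrm y <= d -> `|B x y| <= C * (c * d).
Proof.
move=> xc yd; have x0 := nrm_ge0 x; have y0 := nrm_ge0 y.
case: BP => _ _ /(_ x y) H; apply: le_trans H _.
by rewrite -mulrA ler_wpM2l // ler_pM.
Qed.

(** The product rule along the two orbits. Since [Ss t] is bounded by [M], [d] does not depend on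
    [t], which later permits telescoping over equal steps. *)
Lemma form_orbit_diff x y b b' : gen_eps Ss x b -> gen_eps Ss y b' ->
  forall e : R, 0 < e -> exists2 d, 0 < d & forall h t, 0 < h -> h < d -> 0 <= t ->
    `|B (Ss (t + h) x) (Ss (t + h) y) - B (Ss t x) (Ss t y)
      - h * (B (Ss t b) (Ss t y) + B (Ss t x) (Ss t b'))| <= h * e.
Proof.
move=> xb yb e e0; pose k := C * (M ^+ 2) * (nrm y + nrm x + nrm b + 1).
have CM : 0 <= C * M ^+ 2 by rewrite mulr_ge0 // sqr_ge0.
have [[x0 y0] b0] := (nrm_ge0 x, nrm_ge0 y, nrm_ge0 b).
have k0 : 0 <= k by rewrite mulr_ge0 // !addr_ge0.
(* The cap at 1 gives [nrm (Ss h x - x) <= h * (nrm b + 1)]; as the increment of [y] is below [eta],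
   the quadratic term is also of order [h * eta]. *)
pose eta := Num.min 1 (e / (k + 1)).
have eta0 : 0 < eta by rewrite lt_min ltr01 divr_gt0 //; lra.
have eta1 : eta <= 1 by rewrite ge_min lexx.
have etae : k * eta <= e.
  have : eta <= e / (k + 1) by rewrite ge_min lexx orbT.
  by rewrite ler_pdivlMr; [nra|lra].
have [d1 d10 H1] := xb _ eta0; have [d2 d20 H2] := yb _ eta0.
have [d3 d30 H3] := adj_strong_cont0 y eta0.
exists (Num.min d1 (Num.min d2 d3)); first by rewrite !lt_min d10 d20.
move=> h t h0; rewrite !lt_min => /and3P[/(H1 _ h0) {}H1 /(H2 _ h0) {}H2].
move=> /(H3 _ (ltW h0)) {}H3 t0.
have lt := adj_rlinear t0.
set r := Ss h x - x - h%:C *: b in H1; set r' := Ss h y - y - h%:C *: b' in H2.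
have -> : B (Ss (t + h) x) (Ss (t + h) y) - B (Ss t x) (Ss t y)
      - h * (B (Ss t b) (Ss t y) + B (Ss t x) (Ss t b')) =
    B (Ss t r) (Ss t y) + B (Ss t x) (Ss t r') +
    B (Ss t (Ss h x - x)) (Ss t (Ss h y - y)).
  have h0' := ltW h0; rewrite !adjD // !(rlinearB _ _ lt) !(rlinearZ _ _ lt) !BE; ring.
have H4 : nrm (Ss h x - x) <= h * (nrm b + 1).
  have -> : Ss h x - x = r + h%:C *: b by rewrite subrK.
  apply: le_trans (nrmD _ _) _; rewrite nrmZ gtr0_norm //; nra.
have F1 : `|B (Ss t r) (Ss t y)| <= C * ((M * (h * eta)) * (M * nrm y)).
  apply: B_le; last exact: adj_nrm.
  by apply: le_trans (adj_nrm _ t0) _; rewrite ler_pM2l.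
have F2 : `|B (Ss t x) (Ss t r')| <= C * ((M * nrm x) * (M * (h * eta))).
  apply: B_le; first exact: adj_nrm.
  by apply: le_trans (adj_nrm _ t0) _; rewrite ler_pM2l.
have F3 : `|B (Ss t (Ss h x - x)) (Ss t (Ss h y - y))| <=
    C * ((M * (h * (nrm b + 1))) * (M * eta)).
  by apply: B_le; apply: le_trans (adj_nrm _ t0) _; rewrite ler_pM2l // ltW.
apply: le_trans (ler_normD _ _) _.
have F4 := ler_normD (B (Ss t r) (Ss t y)) (B (Ss t x) (Ss t r')).
have F5 : h * (k * eta) <= h * e by rewrite ler_pM2l.
have F6 : h * (k * eta) = C * ((M * (h * eta)) * (M * nrm y)) +
    C * ((M * nrm x) * (M * (h * eta))) + C * ((M * (h * (nrm b + 1))) * (M * eta)).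
  by rewrite /k; ring.
by rewrite F6 in F5; lra.
Qed.

Lemma form_eq0 :
  (forall x y b b', gen_eps Ss x b -> gen_eps Ss y b' -> B b y + B x b' = 0) ->
  forall x y, B x y = 0.
Proof.
move=> B0.
have dom0 x y b b' : gen_eps Ss x b -> gen_eps Ss y b' -> B x y = 0.
  move=> xb yb; apply/eqP; rewrite -normr_le0; apply/ler_addgt0Pl => e' e'0.
  rewrite addr0; pose e := e' / 2; have e0 : 0 < e by rewrite /e; lra.
  pose k := C * (M * nrm x * (M * nrm y)).
  have k0 : 0 <= k by have M0 := ltW M_gt0; rewrite !mulr_ge0 ?nrm_ge0.
  have ea : 0 < 2 * alpha * e by rewrite !mulr_gt0.
  (* Large enough that [k * expR (- (2 * alpha * T)) <= e], by the bound [1 + u <= expR u]. *)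
  pose T := k / (2 * alpha * e) + 1.
  have T0 : 0 < T by rewrite /T; have := divr_ge0 k0 (ltW ea); lra.
  have BT : `|B (Ss T x) (Ss T y)| <= e.
    apply: le_trans (B_le (adj_nrm_exp x (ltW T0)) (adj_nrm_exp y (ltW T0))) _.
    have -> : C * (M * expR (- (alpha * T)) * nrm x * (M * expR (- (alpha * T)) * nrm y))
       = k * expR (- (2 * alpha * T)).
      rewrite (_ : - (2 * alpha * T) = - (alpha * T) - alpha * T); last ring.
      by rewrite expRD /k; ring.
    rewrite expRN ler_pdivrMr ?expR_gt0 //.
    apply: (@le_trans _ _ (e * (1 + 2 * alpha * T))); last first.
      by rewrite ler_pM2l // expR_ge1Dx.
    have : 2 * alpha * e * T = k + 2 * alpha * e.
      by rewrite /T; field; rewrite !gt_eqF.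
    by nra.
  have eT : 0 < e / T by rewrite divr_gt0.
  have [d d0 H] := form_orbit_diff xb yb eT.
  (* Equal steps shorter than [d]: each changes the form by at most [h * (e / T)], hence by at most
     [e] in total. *)
  pose n := (Num.trunc (T / d)).+1; pose h := T / n%:R.
  have n0 : 0 < n%:R :> R by [].
  have h0 : 0 < h by rewrite divr_gt0.
  have hd : h < d.
    by rewrite /h ltr_pdivrMr // mulrC -ltr_pdivrMr // truncnS_gt.
  have tel m : `|B (Ss (m%:R * h) x) (Ss (m%:R * h) y) - B x y| <= m%:R * (h * (e / T)).
    elim: m => [|m IH]; first by rewrite !mul0r !adj0 subrr normr0.
    have m0 : 0 <= m%:R * h by rewrite mulr_ge0 // ltW.
    have := H h (m%:R * h) h0 hd m0.
    rewrite (B0 _ _ _ _ (adj_gen_orbit m0 xb) (adj_gen_orbit m0 yb)) mulr0 subr0 => H'.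
    rewrite -addn1 natrD !mulrDl !mul1r.
    apply: le_trans (ler_distD (B (Ss (m%:R * h) x) (Ss (m%:R * h) y)) _ _) _; lra.
  have nh : n%:R * h = T by rewrite /h mulrC divfK // gt_eqF.
  have := tel n; rewrite nh mulrA nh mulrC divfK ?gt_eqF // => H1.
  have -> : B x y = B (Ss T x) (Ss T y) - (B (Ss T x) (Ss T y) - B x y) by ring.
  by apply: le_trans (ler_normB _ _) _; rewrite /e in BT H1; lra.
move=> x y; apply/eqP; rewrite -normr_le0; apply/ler_addgt0Pl => e e0; rewrite addr0.
have [x0 y0] := (nrm_ge0 x, nrm_ge0 y).
pose k := C * (nrm x + nrm y + 1).
have k0 : 0 <= k by rewrite mulr_ge0 // !addr_ge0.
(* The distance to approximants in the domain; the cap at 1 bounds the norm of [x'] by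
   [nrm x + 1]. *)
pose eta := Num.min 1 (e / (k + 1)).
have eta0 : 0 < eta by rewrite lt_min ltr01 divr_gt0 //; lra.
have eta1 : eta <= 1 by rewrite ge_min lexx.
have etae : k * eta <= e.
  have : eta <= e / (k + 1) by rewrite ge_min lexx orbT.
  by rewrite ler_pdivlMr; [nra|lra].
have [x' [b [xb /ltW xx]]] := adj_dom_dense x eta0.
have [y' [b' [yb /ltW yy]]] := adj_dom_dense y eta0.
have x'1 : nrm x' <= nrm x + 1.
  have -> : x' = x - (x - x') by rewrite opprB addrCA subrr addr0.
  by apply: le_trans (nrmB _ _) _; lra.
have -> : B x y = B (x - x') y + B x' (y - y') + B x' y' by rewrite !BE; ring.
rewrite (dom0 _ _ _ _ xb yb) addr0; apply: le_trans (ler_normD _ _) _.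
have H1 := B_le xx (lexx (nrm y)); have H2 := B_le x'1 yy.
by apply: le_trans (lerD H1 H2) _; apply: le_trans etae; rewrite /k; lra.
Qed.

End BoundedForm.

(** * The form given by the integral of [W] along adjoint orbits *)

Section ConjugatedForm.
Variables (W : V -> V) (K : R).
Hypotheses (K_ge0 : 0 <= K) (lW : rlinear W) (bW : rbounded K W).

Let w x y t := rp (W (Ss t x)) (Ss t y).

Let w_unif x y : unif_continuous_hl (w x y).
Proof.
move=> e e0; pose k := K * M * (nrm y + nrm x) + 1.
have [x0 y0] := (nrm_ge0 x, nrm_ge0 y).
have KM : 0 <= K * M by rewrite mulr_ge0 // ltW.
have k0 : 0 < k by rewrite /k; have := mulr_ge0 KM (addr_ge0 y0 x0); lra.
have ek : 0 < e / k by rewrite divr_gt0.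
have [d d0 Hd] := adj_unif x ek; have [d' d'0 Hd'] := adj_unif y ek.
exists (Num.min d d'); first by rewrite lt_min d0.
move=> s h s0 h0; rewrite lt_min => /andP[hd hd'].
have {}Hd := Hd s h s0 h0 hd; have {}Hd' := Hd' s h s0 h0 hd'.
have -> : w x y (s + h) - w x y s = rp (W (Ss (s + h) x - Ss s x)) (Ss (s + h) y) +
    rp (W (Ss s x)) (Ss (s + h) y - Ss s y).
  by rewrite /w (rlinearB _ _ lW) !rpE; ring.
have F1 : `|rp (W (Ss (s + h) x - Ss s x)) (Ss (s + h) y)| <= K * (e / k) * (M * nrm y).
  apply: le_trans (rip_le ipP _ _) _; apply: ler_pM; rewrite ?nrm_ge0 //.
    by apply: le_trans (bW _) _; rewrite ler_wpM2l // ltW.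
  by apply: adj_nrm; rewrite addr_ge0.
have F2 : `|rp (W (Ss s x)) (Ss (s + h) y - Ss s y)| <= K * (M * nrm x) * (e / k).
  apply: le_trans (rip_le ipP _ _) _; apply: ler_pM; rewrite ?nrm_ge0 //; last exact: ltW.
  by apply: le_trans (bW _) _; rewrite ler_wpM2l // adj_nrm.
apply: le_lt_trans (ler_normD _ _) _; apply: le_lt_trans (lerD F1 F2) _.
have -> : K * (e / k) * (M * nrm y) + K * (M * nrm x) * (e / k) = (k - 1) * (e / k).
  by set z := e / k; rewrite /k; ring.
by rewrite mulrBl mulrC divfK ?gt_eqF //; lra.
Qed.

Let w_exp x y t : 0 <= t ->
  `|w x y t| <= K * M ^+ 2 * nrm x * nrm y * expR (- (2 * alpha * t)).
Proof.
move=> t0; apply: le_trans (rip_le ipP _ _) _.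
rewrite (_ : _ * expR _ = (K * (M * expR (- (alpha * t)) * nrm x)) *
   (M * expR (- (alpha * t)) * nrm y)); last first.
  rewrite (_ : - (2 * alpha * t) = - (alpha * t) - alpha * t); last ring.
  by rewrite expRD; ring.
apply: ler_pM; rewrite ?nrm_ge0 ?adj_nrm_exp //.
by apply: le_trans (bW _) _; rewrite ler_wpM2l // adj_nrm_exp.
Qed.

Let alpha2 : 0 < 2 * alpha. Proof. by rewrite mulr_gt0. Qed.

Lemma conj_form_integrable x y : integrable_hl (fun t => rp (W (Ss t x)) (Ss t y)).
Proof.
exact: integrable_hl_unif_continuous alpha2 (w_unif x y) (w_exp x y).
Qed.

Lemma conj_form_bounded : bounded_form (K * M ^+ 2 / (2 * alpha))
  (fun x y => integral_hl (fun t => rp (W (Ss t x)) (Ss t y))).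
Proof.
split=> [a x x' y|a x y y'|x y].
- rewrite -integral_hlZ; last exact: conj_form_integrable.
  rewrite -integral_hlD; [|exact/integrable_hlZ/conj_form_integrable|exact: conj_form_integrable].
  by apply: eq_integral_hl => t t0; rewrite adj_rlinear // lW !rpE.
- rewrite -integral_hlZ; last exact: conj_form_integrable.
  rewrite -integral_hlD; [|exact/integrable_hlZ/conj_form_integrable|exact: conj_form_integrable].
  by apply: eq_integral_hl => t t0; rewrite adj_rlinear // !rpE.
- rewrite (_ : _ / _ * _ * _ = K * M ^+ 2 * nrm x * nrm y / (2 * alpha)); last ring.
  apply: le_norm_integral_hl_exp => //; first exact: conj_form_integrable.
  exact: w_exp.
Qed.

(** The increment of the form from [(x, y)] to [(Ss h x, Ss h y)] is computed twice: the product
    rule gives the left side, the shift of the integral gives the right. *)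
Lemma conj_form_generator x y b b' : gen_eps Ss x b -> gen_eps Ss y b' ->
  integral_hl (fun t => rp (W (Ss t b)) (Ss t y)) +
  integral_hl (fun t => rp (W (Ss t x)) (Ss t b')) = - rp (W x) y.
Proof.
move=> xb yb; apply/eqP; rewrite -subr_eq0 opprK -normr_le0.
apply/ler_addgt0Pl => e' e'0; rewrite addr0.
pose e := e' / 2; have e0 : 0 < e by rewrite /e; lra.
have C0 : 0 <= K * M ^+ 2 / (2 * alpha).
  by rewrite divr_ge0 ?mulr_ge0 ?sqr_ge0 // ltW.
have [d d0 Hd] := form_orbit_diff C0 conj_form_bounded xb yb e0.
have [d' d'0 Hd'] := w_unif x y e0.
pose h := Num.min d d' / 2.
have [h0 hd hd'] : [/\ 0 < h, h < d & h < d'].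
  have dd : 0 < Num.min d d' by rewrite lt_min d0.
  have d1 : Num.min d d' <= d by rewrite ge_min lexx.
  have d2 : Num.min d d' <= d' by rewrite ge_min lexx orbT.
  by split; rewrite /h; lra.
have := Hd h 0 h0 hd (lexx 0); rewrite add0r !adj0.
have := @integral_hl_shift_dist _ _ h (rp (W x) y) e (ltW h0) (conj_form_integrable x y).
have -> : integral_hl (fun t => rp (W (Ss (t + h) x)) (Ss (t + h) y)) =
    integral_hl (fun t => rp (W (Ss t (Ss h x))) (Ss t (Ss h y))).
  by apply: eq_integral_hl => t t0; have h0' := ltW h0; rewrite !adjD.
set I1 := integral_hl _; set I2 := integral_hl _.
set I3 := integral_hl _; set I4 := integral_hl _ => H1 H2.
have {}H1 : `|I1 - I2 - h * rp (W x) y| <= h * e.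
  apply: H1 => t /andP[t0 th]; have := Hd' 0 t (lexx 0) t0 (le_lt_trans th hd').
  by rewrite add0r /w !adj0 => /ltW.
rewrite -(@ler_pM2l _ h) // -[X in X * _](gtr0_norm h0) -normrM.
have -> : h * (I3 + I4 + rp (W x) y) =
  - ((I2 - I1 - h * (I3 + I4)) + (I1 - I2 - h * rp (W x) y)) by ring.
rewrite normrN; apply: le_trans (ler_normD _ _) _.
by rewrite /e in H1 H2; lra.
Qed.

End ConjugatedForm.

(** The difference of the two sides meets the hypothesis of [form_eq0]: along the generator both
    terms produce [- rp (W x) y], the first by [gen_adj] at [Y x], the second by
    [conj_form_generator]. *)
Lemma strong_lyapunov_form (W Y : V -> V) (Kw Ky : R) :
  0 <= Kw -> rlinear W -> rbounded Kw W -> 0 <= Ky -> rlinear Y -> rbounded Ky Y ->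
  (forall x b, gen_eps Ss x b -> gen_eps S (Y x) (- W x - Y b)) ->
  forall x y, rp (Y x) y = integral_hl (fun t => rp (W (Ss t x)) (Ss t y)).
Proof.
move=> Kw0 lW bW Ky0 lY bY YW x y; apply/eqP; rewrite -subr_eq0; apply/eqP.
have [B1l B1r B1b] := conj_form_bounded Kw0 lW bW.
pose C := Ky + Kw * M ^+ 2 / (2 * alpha).
have C0 : 0 <= C.
  by rewrite addr_ge0 // divr_ge0 ?mulr_ge0 ?sqr_ge0 // ltW.
have BP : bounded_form C (fun x y =>
    rp (Y x) y - integral_hl (fun t => rp (W (Ss t x)) (Ss t y))).
  split=> [a u u' v|a u v v'|u v].
  - by rewrite B1l lY !rpE; ring.
  - by rewrite B1r !rpE; ring.
  - apply: le_trans (ler_normB _ _) _.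
    have -> : C * nrm u * nrm v =
        Ky * nrm u * nrm v + Kw * M ^+ 2 / (2 * alpha) * nrm u * nrm v by rewrite /C; ring.
    apply: lerD; last exact: B1b.
    apply: le_trans (rip_le ipP _ _) _; rewrite ler_wpM2r ?nrm_ge0 //; exact: bY.
apply: (form_eq0 C0 BP) => u v b b' ub vb.
have H1 := conj_form_generator Kw0 lW bW ub vb.
have := gen_adj (YW _ _ ub) vb; rewrite !rpE; lra.
Qed.

(** * Integral and strong Riccati equations, and the trace bound *)

(** With this operator as a fixed source [W], the Riccati equation becomes a linear Lyapunov
    equation. *)
Definition riccati_op (Q G X : V -> V) (x : V) : V := Q x - X (G (X x)).

Lemma riccati_op_rlinear Q G X : rlinear Q -> rlinear G -> rlinear X ->
  rlinear (riccati_op Q G X).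
Proof.
move=> lQ lG lX a x y; rewrite /riccati_op lQ lX lG lX.
by apply: (rip_ext ipP) => z; rewrite !rpE; ring.
Qed.

Lemma riccati_op_rbounded Q G X : bounded_op Q -> bounded_op G -> bounded_op X ->
  exists2 K, 0 <= K & rbounded K (riccati_op Q G X).
Proof.
move=> /bounded_op_rbounded[Kq Kq0 bQ] /bounded_op_rbounded[Kg Kg0 bG].
move=> /bounded_op_rbounded[Kx Kx0 bX].
exists (Kq + Kx * (Kg * Kx)) => [|x]; first by rewrite addr_ge0 // !mulr_ge0.
apply: le_trans (nrmB _ _) _; rewrite mulrDl; apply: lerD; first exact: bQ.
apply: le_trans (bX _) _; rewrite -!mulrA ler_wpM2l //.
by apply: le_trans (bG _) _; rewrite ler_wpM2l.
Qed.

Lemma riccati_integral_real Q G X x y : riccati_integral_eq ip S Ss Q G X ->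
  integrable_hl (fun t => rp (S t (riccati_op Q G X (Ss t x))) y) /\
  rp (X x) y = integral_hl (fun t => rp (S t (riccati_op Q G X (Ss t x))) y).
Proof. by move=> /(_ x y)[[iRe _] E]; split=> //; rewrite [LHS]/rip E. Qed.

Lemma riccati_integral_strong Q G X : bounded_op Q -> bounded_op G -> bounded_op X ->
  riccati_integral_eq ip S Ss Q G X -> strong_riccati S Ss Q G X.
Proof.
move=> bQ bG bX XE x [b /gen_limP xb].
have [K K0 bW] := riccati_op_rbounded bQ bG bX.
have [Kx Kx0 bX'] := bounded_op_rbounded bX.
have lX := bounded_op_rlinear bX.
have lW := riccati_op_rlinear (bounded_op_rlinear bQ) (bounded_op_rlinear bG) lX.
exists (- riccati_op Q G X x - X b), b; split; last split; last 1 first.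
- by rewrite /riccati_op; apply: (rip_ext ipP) => z; rewrite !rpE; ring.
- apply/gen_limP; apply: (lyapunov_generator lW bW K0 lX bX' Kx0 _ xb) => u v.
  exact: riccati_integral_real.
- exact/gen_limP.
Qed.

Lemma strong_riccati_integral Q G Y : bounded_op Q -> bounded_op G -> bounded_op Y ->
  strong_riccati S Ss Q G Y -> riccati_integral_eq ip S Ss Q G Y.
Proof.
move=> bQ bG bY YS.
have [K K0 bW] := riccati_op_rbounded bQ bG bY.
have [Ky Ky0 bY'] := bounded_op_rbounded bY.
have lY := bounded_op_rlinear bY.
have lW := riccati_op_rlinear (bounded_op_rlinear bQ) (bounded_op_rlinear bG) lY.
have YW x b : gen_eps Ss x b -> gen_eps S (Y x) (- riccati_op Q G Y x - Y b).
  move=> xb; have [|a [b' [/gen_limP ya [/gen_limP xb' E]]]] := YS x.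
    by exists b; apply/gen_limP.
  suff -> : - riccati_op Q G Y x - Y b = a by [].
  (* The strong equation supplies its own limit [b'], identified with [b] by uniqueness. *)
  rewrite (gen_eps_unique ipP xb xb'); apply: (rip_ext ipP) => z.
  have : rp (a + Y b' - Y (G (Y x)) + Q x) z = 0 by rewrite E (rip0l ipP).
  by rewrite /riccati_op !rpE; lra.
have YE := strong_lyapunov_form K0 lW bW Ky0 lY bY' YW.
have adjE x y t : 0 <= t -> rp (riccati_op Q G Y (Ss t x)) (Ss t y) =
  rp (S t (riccati_op Q G Y (Ss t x))) y by move=> t0; rewrite semigroup_adj.
have iE x y : integrable_hl (fun t => rp (S t (riccati_op Q G Y (Ss t x))) y).
  exact: eq_integrable_hl (adjE x y) (conj_form_integrable K0 lW bW x y).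
have YE' x y : rp (Y x) y = integral_hl (fun t => rp (S t (riccati_op Q G Y (Ss t x))) y).
  by rewrite YE; apply: eq_integral_hl (adjE x y).
(* The imaginary half of the integral equation is the real one tested on ['i *: y]. *)
have ImE x y : (fun t => complex.Im (ip (S t (riccati_op Q G Y (Ss t x))) y)) =
    (fun t => rp (S t (riccati_op Q G Y (Ss t x))) ('i *: y)).
  by apply/funext => t; rewrite (Im_ip ipP).
move=> x y; split.
  split; first exact: iE.
  have := iE x ('i *: y); rewrite -ImE; exact.
apply/eqP; rewrite eq_complex; apply/andP; split; apply/eqP; first exact: YE'.
have := YE' x ('i *: y); rewrite -ImE -(Im_ip ipP); exact.
Qed.

(** By symmetry of [X], the discarded term is the form of [G] at [X (Ss t x)], which is
    nonnegative. *)
Lemma riccati_integrand_le Q G X x t : symmetric_op ip X -> psd_op ip G ->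
  symmetric_op ip Q -> 0 <= t ->
  rp (S t (riccati_op Q G X (Ss t x))) x <= rp (Ss t x) (Q (Ss t x)).
Proof.
move=> sX pG sQ t0; rewrite semigroup_adj // /riccati_op (ripBl ipP) lerBlDr.
rewrite [X in X <= _]/rip sQ lerDl /rip sX (_ : complex.Re _ = rp (G (X (Ss t x))) (X (Ss t x))) //.
by rewrite (ripC ipP); have := pG (X (Ss t x)); rewrite lecE => /andP[].
Qed.

(** Complex homogeneity is transferred from [S t]: multiplication by ['i] is skew for [rip], and the
    two signs cancel. *)
Let adj_i t y : 0 <= t -> Ss t ('i *: y) = 'i *: Ss t y.
Proof.
move=> t0; apply: (rip_ext ipP) => x.
have Si : S t ('i *: x) = 'i *: S t x.
  have [lS _] : bounded_op (S t) by case: SC0 => bS _; exact: bS.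
  have := lS 'i x 0; rewrite !addr0 (rlinear0 (S_rlinear t0)) addr0; exact.
rewrite (ripC ipP) -semigroup_adj // -[LHS]opprK -(rip_iC ipP) -Si.
by rewrite semigroup_adj // (rip_iC ipP) opprK (ripC ipP).
Qed.

(** A partial trace of [X] is the integral of a finite sum. Dropping the quadratic term and applying
    the conjugation estimate bounds the integrand by [M ^+ 2 * tr * expR (- (2 * alpha * t))], whose
    integral yields the constant. *)
Lemma trace_riccati_le Q G X (I : countType) (e : I -> V) (tr : R) :
  orthonormal_basis ip e -> bounded_op Q -> symmetric_op ip Q -> psd_op ip Q ->
  psd_op ip G -> symmetric_op ip X -> riccati_integral_eq ip S Ss Q G X ->
  (forall s, uniq s -> \sum_(i <- s) rp (e i) (Q (e i)) <= tr) ->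
  forall s, uniq s -> \sum_(i <- s) rp (e i) (X (e i)) <= M ^+ 2 / (2 * alpha) * tr.
Proof.
move=> eB bQ sQ pQ pG sX XE trQ s us.
have [K K0 bQ'] := bounded_op_rbounded bQ; have lQ := bounded_op_rlinear bQ.
have sQ' : rsym ip Q by move=> x y; rewrite /rip sQ.
have pQ' : rpsd ip Q by move=> x; have := pQ x; rewrite lecE => /andP[].
have Qi x : Q ('i *: x) = 'i *: Q x.
  by case: bQ => /(_ 'i x 0) + _; rewrite !addr0 (rlinear0 lQ) addr0.
pose g i t := rp (S t (riccati_op Q G X (Ss t (e i)))) (e i).
have gi i : integrable_hl (g i) by have [] := riccati_integral_real (e i) (e i) XE.
have [si sE] := integral_hl_sum s gi.
have -> : \sum_(i <- s) rp (e i) (X (e i)) = integral_hl (fun t => \sum_(i <- s) g i t).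
  rewrite sE; apply: eq_bigr => i _; rewrite (ripC ipP).
  by have [_] := riccati_integral_real (e i) (e i) XE.
have a2 : 0 < 2 * alpha by rewrite mulr_gt0.
rewrite mulrAC -(integral_hl_exp (M ^+ 2 * tr) a2).
apply: le_integral_hl => // [|t t0]; first exact: integrable_hl_exp.
apply: (@le_trans _ _ (\sum_(i <- s) rp (Ss t (e i)) (Q (Ss t (e i))))).
  by apply: ler_sum => i _; exact: riccati_integrand_le.
have := complex_trace_conj_le (T := S t) (Ts := Ss t) ipP eB lQ sQ' pQ' K0 bQ'
  (_ : 0 <= M * expR (- (alpha * t))) _ _ Qi _ trQ us.
have -> : (M * expR (- (alpha * t))) ^+ 2 * tr = M ^+ 2 * tr * expR (- (2 * alpha * t)).
  rewrite (_ : - (2 * alpha * t) = - (alpha * t) - alpha * t); last ring.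
  by rewrite expRD; ring.
apply; first by rewrite mulr_ge0 ?expR_ge0 // ltW.
- by move=> x y; rewrite semigroup_adj.
- by move=> x; exact: semigroup_nrm_exp.
- by move=> x; exact: adj_i.
Qed.

End StableSemigroup.

Theorem theorem1 (R : realType) (V : completeNormedModType R[i])
  (ip : V -> V -> R[i]) (S Ss : R -> V -> V) (M alpha : R) (Q G X : V -> V) :
  is_inner_product ip -> separable_space V ->
  C0_semigroup S -> adjoint_family ip S Ss ->
  0 < M -> 0 < alpha -> exp_bound S M alpha ->
  bounded_op Q -> symmetric_op ip Q -> psd_op ip Q ->
  bounded_op G -> symmetric_op ip G -> psd_op ip G ->
  bounded_op X -> symmetric_op ip X -> psd_op ip X ->
  riccati_integral_eq ip S Ss Q G X ->
  (forall Y, bounded_op Y -> symmetric_op ip Y -> psd_op ip Y ->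
     riccati_integral_eq ip S Ss Q G Y -> Y = X) ->
  strong_riccati S Ss Q G X /\
  (forall Y, bounded_op Y -> symmetric_op ip Y -> psd_op ip Y ->
     strong_riccati S Ss Q G Y -> Y = X) /\
  (forall (I : countType) (e : I -> V), orthonormal_basis ip e ->
     (trace_psd ip e Q < +oo)%E ->
     (trace_psd ip e X < +oo)%E /\
     (trace_psd ip e X <= (M ^+ 2 / (2 * alpha))%:E * trace_psd ip e Q)%E).
Proof.
move=> ipP _ SC0 Sadj M0 a0 Sexp bQ sQ pQ bG sG pG bX sX pX XE Xuniq.
split; first exact: (riccati_integral_strong ipP SC0 Sadj M0 a0 Sexp).
split=> [Y bY sY pY YS|I e eB trQ].
  apply: Xuniq => //.
  exact: (strong_riccati_integral ipP SC0 Sadj M0 a0 Sexp).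
have trQ0 : (0 <= trace_psd ip e Q)%E.
  by apply: esum_ge0 => i _; rewrite lee_fin; have := pQ (e i); rewrite lecE => /andP[].
(* The trace of [Q] is nonnegative and finite, hence a real number, so only finite real sums remain
   to be compared. *)
have trE : trace_psd ip e Q = (fine (trace_psd ip e Q))%:E.
  by rewrite fineK // ge0_fin_numE.
suff le : (trace_psd ip e X <= (M ^+ 2 / (2 * alpha))%:E * trace_psd ip e Q)%E.
  by split=> //; apply: le_lt_trans le _; rewrite trE -EFinM ltry.
rewrite trE -EFinM; apply: esum_le_real.
apply: (trace_riccati_le ipP SC0 Sadj M0 a0 Sexp eB bQ sQ pQ pG sX XE) => s us.
by rewrite -lee_fin -trE; exact: sum_le_esum.
Qed.
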